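(* Let $k\ge3$ be an odd integer and $s>\frac52$. Let $(u^\omega,v^\omega)$ be the random pair of functions on $\mathbb{T}^3$ \[u^\omega(x)=\sum_{n\in\mathbb{Z}^3}\frac{g_n}{\langle n\rangle^{s+1}}e^{in\cdot x},\qquad v^\omega(x)=\sum_{n\in\mathbb{Z}^3}\frac{h_n}{\langle n\rangle^{s}}e^{in\cdot x},\] and for $t>0$ let $(\tilde u(t),\tilde v(t))$ be the solution at time $t$ of the dispersionless system \[\partial_t u=v,\qquad \partial_t v=-u^k,\] solved pointwise in $x\in\mathbb{T}^3$, with initial data $(u(0),v(0))=(u^\omega,v^\omega)$. Then, for every $t>0$, the law of $(\tilde u(t),\tilde v(t))$ is not absolutely continuous with respect to the law of $(u^\omega,v^\omega)$.
   Context: $\langle n\rangle=(1+|n|^2)^{1/2}$; $g_n,h_n$ ($n\in\mathbb{Z}^3$) are standard complex Gaussian random variables, independent except for $g_{-n}=\overline{g_n}$, $h_{-n}=\overline{h_n}$ ($n\ne0$), with $g_0,h_0$ real. The ODE is global in time since it conserves $\frac12 v^2+\frac1{k+1}u^{k+1}$ at each point $x$. *)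

(* Defs.v *)
From HB Require Import structures.
From mathcomp Require Import all_boot all_order all_algebra.
From mathcomp Require Import all_classical all_reals all_analysis.
Set Implicit Arguments. Unset Strict Implicit. Unset Printing Implicit Defensive.
Import Order.TTheory GRing.Theory Num.Theory.
Import numFieldNormedType.Exports.
Local Open Scope classical_set_scope.
Local Open Scope ring_scope.

Definition Z3 := (int * int * int)%type.
(* points x = (x1,x2,x3) of R^3; functions on T^3 = R^3/(2 pi Z)^3 are
   represented as (2pi-periodic) functions on R^3 *)
Definition pt3 (R : realType) := (R * R * R)%type.

Definition Z3neg (n : Z3) : Z3 := (- n.1.1, - n.1.2, - n.2)%R.

(* n "positive" in the lexicographic order: a set of representatives of
   (Z^3 \ {0}) / {n ~ -n} *)
Definition Z3pos (n : Z3) : bool :=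
  (0 < n.1.1) || ((n.1.1 == 0) && ((0 < n.1.2) || ((n.1.2 == 0) && (0 < n.2)))).

Definition jbr (R : realType) (n : Z3) : R :=
  Num.sqrt (1 + (n.1.1)%:~R ^+ 2 + (n.1.2)%:~R ^+ 2 + (n.2)%:~R ^+ 2).

Definition dotZ3 (R : realType) (n : Z3) (x : pt3 R) : R :=
  (n.1.1)%:~R * x.1.1 + (n.1.2)%:~R * x.1.2 + (n.2)%:~R * x.2.

Definition cube_sum (R : realType) (N : nat) (F : Z3 -> R) : R :=
  \sum_(i < (N + N).+1) \sum_(j < (N + N).+1) \sum_(l < (N + N).+1)
     F ((i%:Z - N%:Z)%R, (j%:Z - N%:Z)%R, (l%:Z - N%:Z)%R).

Definition mutually_independent d (Omega : measurableType d) (R : realType)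
  (P : probability Omega R) (I : choiceType) (J : set I) (X : I -> Omega -> R) :=
  forall (S : seq I), uniq S -> {subset S <= J} ->
  forall (B : I -> set R), (forall i, i \in S -> measurable (B i)) ->
  P (\bigcap_(i in [set i | i \in S]) (X i @^-1` B i)) =
  \big[*%E/1%E]_(i <- S) P (X i @^-1` B i).

Definition is_centered_normal d (Omega : measurableType d) (R : realType)
  (P : probability Omega R) (sigma : R) (X : Omega -> R) :=
  measurable_fun setT X /\
  forall B : set R, measurable B -> P (X @^-1` B) = normal_prob 0 sigma B.

Definition cyl_gen (R : realType) : set (set (pt3 R -> R * R)) :=
  [set A | exists (x : pt3 R) (B : set (R * R)),
      measurable B /\ A = (fun f => f x) @^-1` B].
Definition cylT (R : realType) := g_sigma_algebraType (@cyl_gen R).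

(* packing the real and imaginary parts  g_n = a_n + i b_n,  h_n = c_n + i e_n
   into a single family indexed by (n, j), j = 0,1,2,3 *)
Definition gauss_family (R : realType) (Omega : Type) (a b c e : Z3 -> Omega -> R)
  (i : Z3 * nat) : Omega -> R :=
  match i.2 with 0 => a i.1 | 1 => b i.1 | 2 => c i.1 | _ => e i.1 end.

(* indices of the independent components: (n, j) with n lexicographically
   positive, and the real parts of g_0, h_0 *)
Definition indep_index : set (Z3 * nat) :=
  [set i | (Z3pos i.1 && (i.2 < 4)%N) ||
           ((i.1 == (0, 0, 0)%R) && ((i.2 == 0)%N || (i.2 == 2)%N))].

(* real part of the n-th term  c_n e^{i n.x} / <n>^p  with c_n = re + i im *)
Definition fourier_term (R : realType) (re im : R) (p : R) (n : Z3) (x : pt3 R) : R :=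
  (re * cos (dotZ3 n x) - im * sin (dotZ3 n x)) / powR (jbr R n) p.

(* Main.v *)
Require Import Defs.
From HB Require Import structures.
From mathcomp Require Import all_boot all_order all_algebra.
From mathcomp Require Import all_classical all_reals all_analysis.
From mathcomp Require Import measurable_realfun zify ring lra.
Import Order.TTheory GRing.Theory Num.Theory.
Import numFieldNormedType.Exports.
Local Open Scope classical_set_scope.
Local Open Scope ring_scope.
Set Implicit Arguments. Unset Strict Implicit. Unset Printing Implicit Defensive.

(** With [g = s - 3/2], the field [v] has local regularity [g] and [u] has regularity
    [g + 1].  The flow mixes them: to first order in small data, [u(t)] is [u + t v], so
    that it is only as regular as [v].  The event separating the two laws is that the
    [m]-th finite difference of the first component at the origin, along the first axis
    with mesh [h = 2^-j], is [O(h^(g + 1/2))] as [j] grows.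

    Finite differences only involve finitely many points for each [h], so Gaussian bounds
    and Borel-Cantelli replace the regularity theory of sample paths.  All these bounds
    come from one formula, [E exp(-l Y^2) = (1 + 2 l Var Y)^(-1/2)]: it gives tails,
    small-ball estimates and, in its two-dimensional form, the positive probability of
    small data at the origin.

    The differences [w = D^m u(r)] of a solution satisfy [w'' = - D^m (u^k)], which by the
    Leibniz rule is [- k u^(k-1) w] up to products of lower-order differences, of size
    [O(h^(g + 1/2))].  By Gronwall, for data small at the origin,
    [|D^m u(t)| >= (t/2) |D^m v(0)| - O(h^(g + 1/2))], while [|D^m v(0)| >= h^(g + 1/4)]
    for all small [h], almost surely. *)

(** * Finite differences *)

(** The law of the solution need only charge some null set of the law of the data, so everything may
    be confined to a small-data event. There [|u| <= th], and since [k >= 3] the coefficient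
    [k th^(k-1)] of the linear term is small: feedback on [w] costs at most half of [t D^m v(0)].
    The condition [s > 5/2], that is [g > 1], tames the remainder. A difference of order [p] is
    bounded by a power of [h] with exponent close to [min(p, g)]; the worst product has two factors
    at the cap, about [h^g] each, and [2 g] must exceed [g + 1/2] with room for the losses. The
    function [exp(-l Y^2)] is used because it is continuous and bounded by 1: its expectation passes
    to the pointwise limit of the Fourier series by dominated convergence, without the law or the
    moments of the limit. The variances are explicit, since
    [|e^(i n_1 h) - 1|^2 = 2 - 2 cos(n_1 h)]. Dyadic meshes keep the event within countably many
    evaluations, hence in the cylinder sigma-algebra, and make powers of [h] geometric in [j]. *)

Definition fdiff (R : realType) (f : nat -> R) : nat -> R := fun i => f i.+1 - f i.

Notation "''D^' l f" := (iter l (@fdiff _) f) (at level 10, l at level 8, f at level 8).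

Lemma fdiffS (R : realType) l (f : nat -> R) i :
  'D^l.+1 f i = 'D^l f i.+1 - 'D^l f i.
Proof. by []. Qed.

Lemma fdiff_shift (R : realType) l (f : nat -> R) i :
  'D^l (fun p => f p.+1) i = 'D^l f i.+1.
Proof. by elim: l i => [//|l IH] i; rewrite !fdiffS !IH. Qed.

Lemma fdiffD (R : realType) l (f g : nat -> R) i :
  'D^l (fun p => f p + g p) i = 'D^l f i + 'D^l g i.
Proof. by elim: l i => [//|l IH] i; rewrite !fdiffS !IH; lra. Qed.

Lemma fdiffZ (R : realType) l (c : R) (f : nat -> R) i :
  'D^l (fun p => c * f p) i = c * 'D^l f i.
Proof. by elim: l i => [//|l IH] i; rewrite !fdiffS !IH; lra. Qed.

Lemma fdiffN (R : realType) l (f : nat -> R) i :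
  'D^l (fun p => - f p) i = - 'D^l f i.
Proof. by elim: l i => [//|l IH] i; rewrite !fdiffS !IH; lra. Qed.

(** The step is [D(f g) = Df . Eg + f . Dg] with [E] the unit shift, followed by Pascal's rule. The
    shift is why the second factor is read at [i + p]. *)
Lemma fdiff_leibniz (R : realType) l (f g : nat -> R) i :
  'D^l (fun p => f p * g p) i =
  \sum_(p < l.+1) 'C(l, p)%:R * ('D^p f i * 'D^(l - p) g (i + p)%N).
Proof.
elim: l f g i => [|l IH] f g i.
  by rewrite big_ord_recl big_ord0 /= addr0 bin0 mul1r addn0.
rewrite iterSr.
have -> : fdiff (fun p => f p * g p) =
    (fun p => fdiff f p * (fun q => g q.+1) p + f p * fdiff g p).
  by apply/funext => p; rewrite /fdiff /=; ring.
rewrite fdiffD !IH.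
under eq_bigr => p _ do rewrite -iterSr fdiff_shift.
under [X in _ + X]eq_bigr => p _ do rewrite -iterSr.
rewrite [RHS]big_ord_recl bin0 mul1r.
under [X in _ = _ + X]eq_bigr => p _ do
  rewrite /= /bump /= add1n binS natrD mulrDl -iterS subSS addnS.
rewrite [X in _ + X]big_ord_recl bin0 mul1r [X in _ = _ + X]big_split /=.
rewrite [X in _ = _ + (X + _)]big_ord_recr /= bin_small // mul0r addr0.
rewrite subn0 addrC -!addrA; congr (_ + _); congr (_ + _).
apply: eq_bigr => p _; rewrite /bump /= add1n.
have pl := ltn_ord p.
by rewrite -(subnSK pl) addnS.
Qed.

(** Only the two extreme Leibniz terms contain a difference of full order. They keep the constant 1,
    because the linear part must stay sharp; the middle binomials are summed crudely to [2 ^+ l]. *)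
Lemma norm_fdiff_mul_le (R : realType) l (f g : nat -> R) i (a b z : R) : (0 < l)%N ->
  `|f i| * `|'D^l g i| <= a -> `|'D^l f i| * `|g (i + l)%N| <= b ->
  (forall p, (0 < p < l)%N -> `|'D^p f i| * `|'D^(l - p) g (i + p)%N| <= z) ->
  0 <= z ->
  `|'D^l (fun p => f p * g p) i| <= a + b + 2 ^+ l * z.
Proof.
case: l => // l _ ha hb hz z0; rewrite fdiff_leibniz.
rewrite big_ord_recl big_ord_recr /= bin0 mul1r addn0.
rewrite /bump /= add1n binn mul1r subnn.
apply: (le_trans (ler_normD _ _)); rewrite -addrA; apply: lerD.
  by rewrite normrM.
apply: (le_trans (ler_normD _ _)); rewrite [leRHS]addrC; apply: lerD; last first.
  by rewrite normrM.
apply: (le_trans (ler_norm_sum _ _ _)).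
apply: (@le_trans _ _ (\sum_(p < l) 'C(l.+1, p.+1)%:R * z)).
  apply: ler_sum => p _; rewrite normrM /bump /= add1n.
  rewrite normr_nat ler_wpM2l // normrM.
  by apply: (hz p.+1); have := ltn_ord p; lia.
rewrite -mulr_suml ler_wpM2r //.
have -> : 2 ^+ l.+1 = (\sum_(p < l.+2) 'C(l.+1, p)%:R : R).
  rewrite -[2]/(1 + 1) exprDn; apply: eq_bigr => p _.
  by rewrite !expr1n mulr1.
rewrite big_ord_recl big_ord_recr /= addrCA lerDl; apply: addr_ge0 => //.
Qed.

(** A discrete chain rule: ['D^l f] carries the factor of the derivative of the power, and all other
    terms are products of lower orders, measured by the weights [eta]. The remainder [z] is separate
    from [eta l] because the top order later needs a better bound than its weight. [K] precedes [f],
    [eta] and [z], so it is uniform in the mesh. *)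
Lemma fdiff_exp_bound (R : realType) (C th : R) (L j : nat) : 0 <= C -> 0 <= th ->
  exists2 K : R, 0 <= K &
  forall (f eta : nat -> R) (M l : nat) (z : R), (0 < l <= L)%N -> 0 <= z ->
    (forall r, 0 <= eta r) ->
    (forall i, (i <= M)%N -> `|f i| <= th) ->
    (forall r i, (0 < r < l)%N -> (i + r <= M)%N -> `|'D^r f i| <= C * eta r) ->
    (forall p q, (0 < p)%N -> (0 < q)%N -> (p + q < l)%N ->
       eta p * eta q <= eta (p + q)%N) ->
    (forall p q, (0 < p)%N -> (0 < q)%N -> (p + q = l)%N -> eta p * eta q <= z) ->
  forall i, (i + l <= M)%N ->
    `|'D^l (fun p => f p ^+ j.+1) i| <= j.+1%:R * th ^+ j * `|'D^l f i| + K * z.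
Proof.
move=> C0 th0; elim: j => [|j [K K0 IH]].
  exists 0 => // f eta M l z _ _ _ _ _ _ _ i _.
  under eq_fun do rewrite expr1.
  by rewrite mulr1 mul1r mul0r addr0.
pose K1 := j.+1%:R * th ^+ j * C + K.
have K10 : 0 <= K1 by rewrite addr_ge0 // !mulr_ge0 // exprn_ge0.
exists (th * K + 2 ^+ L * (C * K1)).
  by rewrite addr_ge0 // ?mulr_ge0 // ?exprn_ge0.
move=> f eta M l z /andP[l0 lL] z0 eta0 fth fC sup supz i iM.
have H1 r p : (0 < r < l)%N -> (p + r <= M)%N ->
    `|'D^r (fun p => f p ^+ j.+1) p| <= K1 * eta r.
  move=> /andP[r0 rl] prM.
  (* At an order [r < l] the remainder [z] is taken to be [eta r], as the product rule for [eta]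
     allows. *)
  apply: (le_trans (IH f eta M r (eta r) _ _ _ _ _ _ _ p prM)) => //.
  - by rewrite r0 (leq_trans (ltnW rl)).
  - by move=> r' i' /andP[r'0 r'r]; apply: fC; rewrite r'0 (ltn_trans r'r).
  - by move=> p' q' p0 q0 pq; apply: sup => //; exact: ltn_trans rl.
  - by move=> p' q' p0 q0 pq; rewrite -pq; apply: sup => //; rewrite pq.
  rewrite /K1 mulrDl lerD2r -!mulrA ler_wpM2l // ler_wpM2l ?exprn_ge0 //.
  by apply: fC => //; rewrite r0.
have -> : (fun p => f p ^+ j.+2) = (fun p => f p * f p ^+ j.+1).
  by apply/funext => p; rewrite exprS.
set d := `|'D^l f i|.
have d0 : 0 <= d := normr_ge0 _.
have IHl : `|'D^l (fun p => f p ^+ j.+1) i| <= j.+1%:R * th ^+ j * d + K * z.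
  by apply: (IH f eta M) => //; rewrite l0.
apply: (@le_trans _ _ (th * (j.+1%:R * th ^+ j * d + K * z) + d * th ^+ j.+1 +
    2 ^+ l * (C * K1 * z))).
  apply: norm_fdiff_mul_le => //.
  - by apply: ler_pM => //; apply: fth; apply: leq_trans iM; exact: leq_addr.
  - rewrite ler_wpM2l // normrX lerXn2r ?nnegrE //; apply: fth.
    exact: iM.
  - move=> p /andP[p0 pl].
    have h1 : `|'D^p f i| <= C * eta p by apply: fC; clear -p0 pl iM; lia.
    have h2 : `|'D^(l - p) (fun p => f p ^+ j.+1) (i + p)%N| <= K1 * eta (l - p)%N.
      by apply: H1; clear -p0 pl iM; lia.
    apply: (le_trans (ler_pM _ _ h1 h2)) => //.
    rewrite mulrACA.
    by rewrite ler_wpM2l ?mulr_ge0 //; apply: supz; clear -p0 pl; lia.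
  - by rewrite !mulr_ge0.
have h2 : 2 ^+ l <= 2 ^+ L :> R by rewrite ler_eXn2l // ltr1n.
have h3 := ler_wpM2r (mulr_ge0 (mulr_ge0 C0 K10) z0) h2.
rewrite -(natr1 j.+1) exprS.
have -> : (j.+1%:R + 1) * (th * th ^+ j) * d + (th * K + 2 ^+ L * (C * K1)) * z =
  th * (j.+1%:R * th ^+ j * d + K * z) + d * (th * th ^+ j) +
    2 ^+ L * (C * K1 * z) by ring.
by rewrite lerD2l.
Qed.

(** * The flow of the dispersionless system *)

Lemma mean_value (R : realType) (f df : R -> R) (a b : R) : a <= b ->
  (forall x : R, is_derive x 1 f (df x)) ->
  exists2 x, a <= x <= b & f b - f a = df x * (b - a).
Proof.
move=> ab hf; have [//|x xab ->] := @MVT_segment R f df a b ab (fun x _ => hf x).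
  apply: derivable_within_continuous => x _; by have [] := hf x.
by exists x => //; rewrite in_itv /= in xab.
Qed.

(** The energy times [exp(-(2 + q) r)] is nonincreasing. Putting [B ^+ 2] into the energy makes the
    inequality homogeneous; [2 + q] collects the cross terms [2 w w1], [2 q |w1| |w|] and
    [2 |w1| B], each split by [2xy <= x^2 + y^2]. *)
Lemma gronwall2 (R : realType) (w w1 w2 : R -> R) (q B t : R) : 0 <= q -> 0 <= B ->
  (forall r : R, is_derive r 1 w (w1 r)) -> (forall r : R, is_derive r 1 w1 (w2 r)) ->
  (forall r : R, 0 <= r <= t -> `|w2 r| <= q * `|w r| + B) ->
  forall r : R, 0 <= r <= t ->
  w r ^+ 2 + w1 r ^+ 2 + B ^+ 2 <= (w 0 ^+ 2 + w1 0 ^+ 2 + B ^+ 2) * expR ((2 + q) * r).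
Proof.
move=> q0 B0 dw dw1 hw2 r /andP[r0 rt].
pose g x := (w x ^+ 2 + w1 x ^+ 2 + B ^+ 2) * expR (- ((2 + q) * x)).
pose dg x := (2 * w x * w1 x + 2 * w1 x * w2 x
   - (2 + q) * (w x ^+ 2 + w1 x ^+ 2 + B ^+ 2)) * expR (- ((2 + q) * x)).
have hg (x : R) : is_derive x 1 g (dg x).
  have de : is_derive x 1 (fun y => expR (- ((2 + q) * y)))
     (expR (- ((2 + q) * x)) * - (2 + q)).
    apply: is_derive1_comp.
    have -> : (fun y : R => - ((2 + q) * y)) = (- (2 + q)) \*: id.
      by apply/funext => y /=; rewrite /GRing.scale /= mulNr.
    by apply: is_derive_eq; rewrite /GRing.scale /= mulr1.
  have -> : g = (w ^+ 2 + w1 ^+ 2 + cst (B ^+ 2)) * (fun y => expR (- ((2 + q) * y))).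
    by apply/funext => y; rewrite /g /= !fctE.
  apply: is_derive_eq.
  by rewrite /dg /GRing.scale /= !fctE /=; ring.
have [x /andP[x0 xr] gE] := mean_value r0 hg.
have dgx : dg x <= 0.
  rewrite /dg -oppr_ge0 -mulNr mulr_ge0 ?expR_ge0 // opprB subr_ge0.
  have xt : 0 <= x <= t by rewrite x0 (le_trans xr).
  have := hw2 x xt; set W := w x; set V := w1 x; set A := w2 x => hA.
  have h1 : 2 * W * V <= W ^+ 2 + V ^+ 2.
    by have := sqr_ge0 (W - V); rewrite sqrrB; lra.
  have h2 : 2 * V * A <= 2 * `|V| * (q * `|W| + B).
    rewrite -!mulrA ler_pM2l // (le_trans (ler_norm _)) // normrM.
    by rewrite ler_wpM2l.
  have h3 : 2 * (`|V| * `|W|) <= W ^+ 2 + V ^+ 2.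
    by have := sqr_ge0 (`|W| - `|V|); rewrite sqrrB !real_normK ?num_real //; lra.
  have h4 : 2 * (`|V| * B) <= V ^+ 2 + B ^+ 2.
    by have := sqr_ge0 (`|V| - B); rewrite sqrrB !real_normK ?num_real //; lra.
  have h5 := ler_wpM2l q0 h3.
  have h6 := sqr_ge0 W. have h7 := sqr_ge0 B.
  have h8 := mulr_ge0 q0 h7.
  lra.
have : g r <= g 0.
  rewrite -subr_le0 gE subr0 mulr_le0_ge0 //.
rewrite /g mulr0 oppr0 expR0 mulr1.
by rewrite expRN ler_pdivrMr ?expR_gt0.
Qed.

Lemma gronwall (R : realType) (w w1 w2 : R -> R) (q B t : R) : 0 <= q -> 0 <= B ->
  (forall r : R, is_derive r 1 w (w1 r)) -> (forall r : R, is_derive r 1 w1 (w2 r)) ->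
  (forall r : R, 0 <= r <= t -> `|w2 r| <= q * `|w r| + B) ->
  forall r : R, 0 <= r <= t ->
  `|w r| <= (`|w 0| + `|w1 0| + B) * expR ((2 + q) * t).
Proof.
move=> q0 B0 dw dw1 hw2 r rt.
have := gronwall2 q0 B0 dw dw1 hw2 rt.
move: rt => /andP[r0 rt] h.
have t0 : 0 <= t by exact: le_trans rt.
have q20 : 0 <= 2 + q by lra.
set X := expR _ in h *; set Y := expR _.
have XY : X <= Y by rewrite ler_expR ler_wpM2l.
have Y1 : 1 <= Y by rewrite -expR0 ler_expR mulr_ge0.
have := normr_ge0 (w 0); have := normr_ge0 (w1 0).
move: h; rewrite -(real_normK (num_real (w 0))) -(real_normK (num_real (w1 0))).
rewrite -(real_normK (num_real (w r))).
set a := `|w 0|; set b := `|w1 0| => h b0 a0.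
have X0 : 0 <= X := expR_ge0 _.
rewrite -(ler_pXn2r (n := 2)) ?nnegrE //; last by rewrite mulr_ge0 ?expR_ge0 ?addr_ge0.
have h1 : a ^+ 2 + b ^+ 2 + B ^+ 2 <= (a + b + B) ^+ 2.
  have := mulr_ge0 a0 b0; have := mulr_ge0 a0 B0; have := mulr_ge0 b0 B0.
  by rewrite !expr2; lra.
have h2 : X <= Y ^+ 2 by rewrite (le_trans XY) // expr2 ler_peMr //; lra.
have h3 : (a ^+ 2 + b ^+ 2 + B ^+ 2) * X <= (a + b + B) ^+ 2 * Y ^+ 2.
  by apply: ler_pM => //; rewrite !addr_ge0 ?sqr_ge0.
rewrite exprMn; have := sqr_ge0 (w1 r); have := sqr_ge0 B; lra.
Qed.

Lemma taylor2_bound (R : realType) (w w1 w2 : R -> R) (K t : R) : 0 <= t ->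
  (forall r : R, is_derive r 1 w (w1 r)) -> (forall r : R, is_derive r 1 w1 (w2 r)) ->
  (forall r : R, 0 <= r <= t -> `|w2 r| <= K) ->
  `|w t - w 0 - t * w1 0| <= t ^+ 2 * K.
Proof.
move=> t0 dw dw1 hK.
have [x /andP[x0 xt] hx] := mean_value t0 dw.
have [y /andP[y0 yx] hy] := mean_value x0 dw1.
have -> : w t - w 0 - t * w1 0 = t * ((w1 x - w1 0)) by rewrite hx; ring.
have K0 : 0 <= K by apply: le_trans (hK 0 _); rewrite ?lexx.
rewrite hy subr0 normrM (ger0_norm t0) expr2 -mulrA ler_wpM2l // normrM mulrC.
rewrite (ger0_norm x0); apply: ler_pM => //.
by apply: hK; rewrite y0 (le_trans yx).
Qed.

Lemma is_derive_fdiff (R : realType) (F G : R -> nat -> R) :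
  (forall i (r : R), is_derive r 1 (fun x => F x i) (G r i)) ->
  forall l i (r : R), is_derive r 1 (fun x => 'D^l (F x) i) ('D^l (G r) i).
Proof. by move=> dF; elim=> [//|l IH] i r; exact: is_deriveB. Qed.

Lemma flow_energy (R : realType) (k : nat) (U V : R -> R) :
  (forall r : R, is_derive r 1 U (V r)) ->
  (forall r : R, is_derive r 1 V (- U r ^+ k)) ->
  forall r, V r ^+ 2 / 2 + U r ^+ k.+1 / k.+1%:R =
            V 0 ^+ 2 / 2 + U 0 ^+ k.+1 / k.+1%:R.
Proof.
move=> dU dV r.
apply: (@is_derive_0_is_cst _ (fun r => V r ^+ 2 / 2 + U r ^+ k.+1 / k.+1%:R)) => x.
have -> : (fun r => V r ^+ 2 / 2 + U r ^+ k.+1 / k.+1%:R) =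
  2^-1 \*: (V ^+ 2) + k.+1%:R^-1 \*: (U ^+ k.+1).
  by apply/funext => y; rewrite !fctE /GRing.scale /= mulrC [X in _ + X]mulrC.
apply: is_derive_eq; rewrite /GRing.scale /= expr1.
by field; rewrite nat1r pnatr_eq0.
Qed.

(** With [k] odd both terms of the conserved energy are nonnegative, so the potential term alone
    confines [U]. *)
Lemma flow_bound (R : realType) (k : nat) (U V : R -> R) (th : R) : odd k -> 0 <= th ->
  (forall r : R, is_derive r 1 U (V r)) ->
  (forall r : R, is_derive r 1 V (- U r ^+ k)) ->
  V 0 ^+ 2 / 2 + U 0 ^+ k.+1 / k.+1%:R <= th ^+ k.+1 / k.+1%:R ->
  forall r, `|U r| <= th.
Proof.
move=> ok th0 dU dV h r; move: h; rewrite -(flow_energy dU dV r) => h.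
have k0 : (0 : R) < k.+1%:R^-1 by rewrite invr_gt0.
rewrite -(@ler_pXn2r _ k.+1) ?nnegrE // -normrX ger0_norm; last first.
  by rewrite exprn_even_ge0 //= ok.
rewrite -(ler_pM2r k0); apply: le_trans h.
by rewrite lerDr divr_ge0 ?sqr_ge0.
Qed.

(** Induction on the order: [w = 'D^l (U r)] solves [w'' = - 'D^l (U^k)], whose right side is at
    most [q |w|] plus products of orders already bounded, and Gronwall applies. [K] precedes [eta]
    and [M], so it serves all meshes at once. *)
Lemma flow_fdiff_bound (R : realType) (C th t : R) (j L : nat) :
  0 <= C -> 0 <= th -> 0 <= t ->
  exists2 K : R, 0 <= K &
  forall (U V : R -> nat -> R) (eta : nat -> R) (M : nat),
    (forall i (r : R), is_derive r 1 (fun x => U x i) (V r i)) ->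
    (forall i (r : R), is_derive r 1 (fun x => V x i) (- U r i ^+ j.+1)) ->
    (forall r, 0 <= eta r) ->
    (forall p q, (0 < p)%N -> (0 < q)%N -> (p + q <= L)%N ->
       eta p * eta q <= eta (p + q)%N) ->
    (forall (r : R) i, 0 <= r <= t -> (i <= M)%N -> `|U r i| <= th) ->
    (forall l i, (0 < l <= L)%N -> (i + l <= M)%N ->
       `|'D^l (U 0) i| <= C * eta l /\ `|'D^l (V 0) i| <= C * eta l) ->
  forall (r : R) l i, 0 <= r <= t -> (0 < l <= L)%N -> (i + l <= M)%N ->
    `|'D^l (U r) i| <= K * eta l.
Proof.
move=> C0 th0 t0; elim: L => [|L [K K0 IH]].
  exists 0 => // U V eta M _ _ _ _ _ _ r l i _; lia.
have [K2 K20 HK2] := fdiff_exp_bound L.+1 j K0 th0.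
pose q := j.+1%:R * th ^+ j; pose E := expR ((2 + q) * t).
have E0 : 0 <= E := expR_ge0 _.
have q0 : 0 <= q by rewrite mulr_ge0 // exprn_ge0.
exists (K + (C + C + K2) * E); first by rewrite addr_ge0 // mulr_ge0 // !addr_ge0.
move=> U V eta M dU dV eta0 sup Uth hC r l i rt /andP[l0 lL] ilM.
have IH' r' l' i' : 0 <= r' <= t -> (0 < l' <= L)%N -> (i' + l' <= M)%N ->
    `|'D^l' (U r') i'| <= K * eta l'.
  apply: (IH U V eta M) => //; first by move=> p p' *; apply: sup => //; exact: leqW.
  by move=> l1 i1 /andP[l10 l1L] i1M; apply: hC => //; rewrite l10 leqW.
have [lL'|lL'] := leqP l L.
  apply: (le_trans (IH' r l i _ _ _)) => //; first by rewrite l0.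
  by rewrite ler_wpM2r // lerDl mulr_ge0 // !addr_ge0.
have {}lL' : l = L.+1 by apply/eqP; rewrite eqn_leq lL.
have dw := is_derive_fdiff dU l i.
have dw1 := is_derive_fdiff (F := V) (G := fun r i => - U r i ^+ j.+1) dV l i.
have hw2 r' : 0 <= r' <= t ->
    `|'D^l (fun p => - U r' p ^+ j.+1) i| <= q * `|'D^l (U r') i| + K2 * eta l.
  move=> rt'; rewrite fdiffN normrN.
  apply: (HK2 (U r') eta M) => //; first by rewrite l0.
  - by move=> p pM; apply: Uth.
  - by move=> p p' h1 h2; apply: IH' => //; clear -h1 lL'; lia.
  - by move=> p p' p0 p'0 pp'; apply: sup => //; clear -pp' lL'; lia.
  - by move=> p p' p0 p'0 pp'; rewrite -pp'; apply: sup => //; rewrite pp' lL'.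
have [h1 h2] : `|'D^l (U 0) i| <= C * eta l /\ `|'D^l (V 0) i| <= C * eta l.
  by apply: hC => //; rewrite l0.
apply: (le_trans (gronwall q0 (mulr_ge0 K20 (eta0 l)) dw dw1 hw2 rt)).
apply: (@le_trans _ _ ((C * eta l + C * eta l + K2 * eta l) * E)).
  by rewrite ler_wpM2r // lerD2r lerD.
have := mulr_ge0 K0 (eta0 l); rewrite -/E; lra.
Qed.

(* The second time derivative of [w = 'D^m (U r) 0] is at most [q |w| + O(z)], so for small
   [q] the top-order difference of [U t] is essentially [t] times that of [V 0]. *)
Lemma flow_fdiff_lower (R : realType) (C th t : R) (j m : nat) :
  0 <= C -> 0 <= th -> 0 <= t -> (0 < m)%N ->
  t * (j.+1%:R * th ^+ j) * expR ((2 + j.+1%:R * th ^+ j) * t) <= 2^-1 ->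
  exists2 K : R, 0 <= K &
  forall (U V : R -> nat -> R) (eta : nat -> R) (z : R),
    (forall i (r : R), is_derive r 1 (fun x => U x i) (V r i)) ->
    (forall i (r : R), is_derive r 1 (fun x => V x i) (- U r i ^+ j.+1)) ->
    (forall r, 0 <= eta r) -> 0 <= z ->
    (forall p q, (0 < p)%N -> (0 < q)%N -> (p + q < m)%N ->
       eta p * eta q <= eta (p + q)%N) ->
    (forall p q, (0 < p)%N -> (0 < q)%N -> (p + q = m)%N -> eta p * eta q <= z) ->
    (forall (r : R) i, 0 <= r <= t -> (i <= m)%N -> `|U r i| <= th) ->
    (forall l i, (0 < l < m)%N -> (i + l <= m)%N ->
       `|'D^l (U 0) i| <= C * eta l /\ `|'D^l (V 0) i| <= C * eta l) ->
    `|'D^m (U 0) 0| <= z -> `|'D^m (U t) 0| <= z ->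
  t / 2 * `|'D^m (V 0) 0| <= K * z.
Proof.
move=> C0 th0 t0 m0.
set q := j.+1%:R * th ^+ j; set E := expR _ => tqE.
have q0 : 0 <= q by rewrite mulr_ge0 // exprn_ge0.
have E0 : 0 <= E := expR_ge0 _.
(* Orders below [m] only: at order [m] there is no upper bound on the data of [V] to propagate. *)
have [K K0 HK] := flow_fdiff_bound j m.-1 C0 th0 t0.
have [K2 K20 HK2] := fdiff_exp_bound m j K0 th0.
(* Taylor gives [t w1 <= 2 z + t^2 (q (z + w1 + K2 z) E + K2 z)]; this is the coefficient of [z] on
   the right. *)
exists (2 + t ^+ 2 * (q * (1 + K2) * E + K2)).
  have h1 : 0 <= 1 + K2 by rewrite addr_ge0.
  rewrite addr_ge0 // mulr_ge0 ?sqr_ge0 // addr_ge0 //.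
  by apply: mulr_ge0 => //; apply: mulr_ge0.
move=> U V eta z dU dV eta0 z0 sup supz Uth hC h0 ht.
have hU r l i : 0 <= r <= t -> (0 < l < m)%N -> (i + l <= m)%N ->
    `|'D^l (U r) i| <= K * eta l.
  move=> rt lm ilm.
  have lm' : (0 < l <= m.-1)%N by clear -lm; lia.
  apply: (HK U V eta m) => //.
    by move=> p p' p0 p'0 pp'; apply: sup => //; clear -pp' m0; lia.
  by move=> l' i' l0 i0; apply: hC => //; clear -l0 m0; lia.
have dw := is_derive_fdiff dU m 0.
have dw1 := is_derive_fdiff (F := V) (G := fun r i => - U r i ^+ j.+1) dV m 0.
have hw2 r : 0 <= r <= t ->
    `|'D^m (fun p => - U r p ^+ j.+1) 0%N| <= q * `|'D^m (U r) 0%N| + K2 * z.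
  move=> rt; rewrite fdiffN normrN.
  apply: (HK2 (U r) eta m) => //; first by rewrite m0 leqnn.
  - by move=> p pM; apply: Uth.
  - by move=> p p' *; apply: hU.
set w0 := `|'D^m (U 0) 0| in h0; set w1 := `|'D^m (V 0) 0|.
have K2z := mulr_ge0 K20 z0.
have hw r : 0 <= r <= t -> `|'D^m (U r) 0%N| <= (z + w1 + K2 * z) * E.
  move=> rt; apply: (le_trans (gronwall q0 K2z dw dw1 hw2 rt)).
  by rewrite ler_wpM2r // lerD2r lerD2r.
have hw2' r : 0 <= r <= t -> `|'D^m (fun p => - U r p ^+ j.+1) 0%N| <=
    q * ((z + w1 + K2 * z) * E) + K2 * z.
  by move=> rt; rewrite (le_trans (hw2 r rt)) // lerD2r ler_wpM2l // hw.
have := taylor2_bound t0 dw dw1 hw2'.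
have w1tE : t * w1 = `|t * 'D^m (V 0) 0%N| by rewrite normrM ger0_norm.
set a := 'D^m (U t) 0%N in ht *; set b := 'D^m (U 0) 0%N in h0 *.
set c := 'D^m (V 0) 0%N in w1tE * => hT.
have h1 : t * w1 <= `|a - b - t * c| + `|a| + `|b|.
  rewrite w1tE (_ : t * c = (a - b) - (a - b - t * c)); last by ring.
  apply: (le_trans (ler_normB _ _)).
  rewrite (_ : a - b - _ = a - b - t * c); last by ring.
  by have := ler_normB a b; lra.
have w10 : 0 <= w1 := normr_ge0 _.
(* Absorption: [t^2 q E w1 <= t w1 / 2], so half of [t w1] survives on the left. *)
have h2 := ler_wpM2r (mulr_ge0 t0 w10) tqE.
have hwz : `|b| <= z by [].
rewrite expr2 in hT *; lra.
Qed.

(** Two solutions are viewed as entries 0 and 1 of a sequence; their gap is a first difference, so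
    the propagation bound at order 1 doubles as Lipschitz dependence on bounded data. *)
Lemma flow_continuous (R : realType) (phi : R -> R -> R -> R * R) (k : nat) (t : R) :
  odd k -> 0 <= t ->
  (forall a0 b0 : R, phi 0 a0 b0 = (a0, b0)) ->
  (forall a0 b0 tau : R,
     is_derive tau 1 (fun r => (phi r a0 b0).1) (phi tau a0 b0).2 /\
     is_derive tau 1 (fun r => (phi r a0 b0).2) (- ((phi tau a0 b0).1 ^+ k))) ->
  forall (a b eps : R), 0 < eps -> exists2 de : R, 0 < de &
  forall x y, `|x - a| <= de -> `|y - b| <= de ->
    `|(phi t x y).1 - (phi t a b).1| < eps.
Proof.
move=> ok t0 phi0 dphi a b eps eps0.
pose A := `|a| + 1; pose B := `|b| + 1.
have A0 : 0 <= A by rewrite addr_ge0.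
have B0 : 0 <= B by rewrite addr_ge0.
(* As [th >= 1], also [th <= th ^+ k.+1], so the energy of data bounded by [A] and [B] lies below
   the level of [th]. *)
pose th := 1 + k.+1%:R * (B ^+ 2 / 2 + A ^+ k.+1 / k.+1%:R).
have Q0 : 0 <= k.+1%:R * (B ^+ 2 / 2 + A ^+ k.+1 / k.+1%:R).
  by rewrite mulr_ge0 // addr_ge0 // divr_ge0 ?exprn_ge0.
have th0 : 0 <= th by rewrite addr_ge0.
have hth x y : `|x| <= A -> `|y| <= B -> forall r, `|(phi r x y).1| <= th.
  move=> xA yB; apply: (@flow_bound _ k _ (fun r => (phi r x y).2)) => //.
  - by move=> r; have [] := dphi x y r.
  - by move=> r; have [] := dphi x y r.
  rewrite !phi0 /=.
  have h1 : th <= th ^+ k.+1.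
    have th1 : 1 <= th by rewrite lerDl.
    by rewrite exprS ler_peMr // exprn_ege1.
  have h2 : y ^+ 2 <= B ^+ 2 by rewrite -(real_normK (num_real y)) lerXn2r ?nnegrE.
  have h3 : x ^+ k.+1 <= A ^+ k.+1.
    apply: (le_trans (ler_norm _)); rewrite normrX lerXn2r ?nnegrE //.
  apply: (@le_trans _ _ (th / k.+1%:R)); last by rewrite ler_pM2r // invr_gt0.
  rewrite ler_pdivlMr // mulrC /th.
  apply: (@le_trans _ _ (k.+1%:R * (B ^+ 2 / 2 + A ^+ k.+1 / k.+1%:R))).
    by rewrite ler_pM2l // lerD // ler_pM2r // invr_gt0.
  by rewrite lerDr.
case: k ok dphi @th Q0 th0 hth => // j ok dphi th Q0 th0 hth.
have [K K0 HK] := @flow_fdiff_bound _ 1 th t j 1 ler01 th0 t0.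
pose de := Num.min 1 (eps / (K + 1)).
have K10 : 0 < K + 1 by lra.
have de0 : 0 < de by rewrite lt_min ltr01 divr_gt0.
exists de => // x y xa yb.
(* The weight will be the constant [de]; at order 1 the product conditions on it are vacuous. *)
pose X (i : nat) := if i == 0%N then a else x.
pose Y (i : nat) := if i == 0%N then b else y.
have aA : `|a| <= A by rewrite lerDl.
have bB : `|b| <= B by rewrite lerDl.
have de1 : de <= 1 by rewrite ge_min lexx.
have xA : `|x| <= A.
  by rewrite -(subrK a x) (le_trans (ler_normD _ _)) // addrC lerD2l (le_trans xa).
have yB : `|y| <= B.
  by rewrite -(subrK b y) (le_trans (ler_normD _ _)) // addrC lerD2l (le_trans yb).
have := HK (fun r i => (phi r (X i) (Y i)).1) (fun r i => (phi r (X i) (Y i)).2)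
   (fun=> de) 1%N.
move=> /(_ _ _ _ _ _ _ t 1%N 0%N); rewrite lexx t0 => H.
apply: (@le_lt_trans _ _ (K * de)).
  apply: H => //.
  - by move=> i r; have [] := dphi (X i) (Y i) r.
  - by move=> i r; have [] := dphi (X i) (Y i) r.
  - by move=> _; exact: ltW.
  - by move=> p q p0 q0 pq; exfalso; clear -p0 q0 pq; lia.
  - by move=> r [|i] _ _; rewrite /X /Y /=; apply: hth.
  - move=> l i h1 h2; have [-> ->] : l = 1%N /\ i = 0%N by clear -h1 h2; lia.
    by rewrite /= /fdiff /= !phi0 /= mul1r /X /Y.
have h : de <= eps / (K + 1) by rewrite ge_min lexx orbT.
rewrite ler_pdivlMr // in h; apply: lt_le_trans h.
by rewrite mulrC ltr_pM2l // ltrDl.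
Qed.

(** * Sums over lattice cubes *)

Definition zrange (N : nat) : seq int := [seq i%:Z - N%:Z | i <- iota 0 (N + N).+1].

Arguments zrange : simpl never.

(** As a duplicate-free list the cube can be reflected, filtered and compared by inclusion. *)
Definition cube (N : nat) : seq Z3 :=
  [seq (p, z) | p <- [seq (x, y) | x <- zrange N, y <- zrange N], z <- zrange N].

Lemma zrange_uniq N : uniq (zrange N).
Proof. by rewrite map_inj_uniq ?iota_uniq // => i j; lia. Qed.

Lemma mem_zrange N (z : int) : (z \in zrange N) = (`|z| <= N%:Z)%R.
Proof.
apply/mapP/idP => [[i]|h]; first by rewrite mem_iota => h ->; lia.
exists (absz (z + N%:Z)); [rewrite mem_iota|]; lia.
Qed.

Lemma cube_uniq N : uniq (cube N).
Proof.
rewrite allpairs_uniq ?zrange_uniq //; last by move=> [? ?] [? ?].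
by rewrite allpairs_uniq ?zrange_uniq // => [[? ?] [? ?]].
Qed.

Lemma mem_allpairs_pair (S T : eqType) (s : seq S) (t : seq T) x y :
  ((x, y) \in [seq (a, b) | a <- s, b <- t]) = (x \in s) && (y \in t).
Proof.
apply/allpairsP/andP => [[[a b] [/= sa tb [-> ->]]]|[sx ty]] //.
by exists (x, y).
Qed.

Lemma mem_cube N (n : Z3) : (n \in cube N) =
  [&& n.1.1 \in zrange N, n.1.2 \in zrange N & n.2 \in zrange N].
Proof. by case: n => [[x y] z]; rewrite !mem_allpairs_pair andbA. Qed.

Lemma big_zrange (R : realType) N (F : int -> R) :
  \sum_(z <- zrange N) F z = \sum_(i < (N + N).+1) F (i%:Z - N%:Z).
Proof.
rewrite big_map (_ : iota _ _ = index_iota 0 (N + N).+1) ?big_mkord //.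
Qed.

Lemma cube_sumE (R : realType) N (F : Z3 -> R) :
  cube_sum N F = \sum_(n <- cube N) F n.
Proof.
rewrite /cube_sum /cube !big_allpairs big_zrange; apply: eq_bigr => i _.
rewrite big_zrange; apply: eq_bigr => j _.
by rewrite big_zrange.
Qed.

Lemma ler_cube_sum (R : realType) N (F G : Z3 -> R) :
  (forall n, F n <= G n) -> cube_sum N F <= cube_sum N G.
Proof. by move=> FG; rewrite !cube_sumE ler_sum. Qed.

(** * The symmetry [n -> -n] and the independent components *)

Lemma Z3negK : involutive Z3neg.
Proof. by case=> [[x y] z]; rewrite /Z3neg /= !opprK. Qed.

Lemma cube_neg N : perm_eq (map Z3neg (cube N)) (cube N).
Proof.
apply: uniq_perm; rewrite ?map_inj_uniq ?cube_uniq //; first exact: can_inj Z3negK.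
move=> n; rewrite -{1}(Z3negK n) mem_map; last exact: can_inj Z3negK.
by rewrite !mem_cube /= !mem_zrange !normrN.
Qed.

Lemma Z3pos_neg (n : Z3) : n != (0, 0, 0) -> ~~ Z3pos n = Z3pos (Z3neg n).
Proof.
case: n => [[x y] z]; rewrite /Z3pos /Z3neg /= !xpair_eqE; lia.
Qed.

Lemma Z3pos0 : Z3pos (0, 0, 0) = false. Proof. by []. Qed.

Lemma cube_sum_even (R : realType) N (F : Z3 -> R) : (forall n, F (Z3neg n) = F n) ->
  cube_sum N F = F (0, 0, 0) + 2 * \sum_(n <- cube N | Z3pos n) F n.
Proof.
move=> Fe; rewrite cube_sumE (@bigD1_seq _ _ _ _ _ (0, 0, 0)) ?cube_uniq //=; last first.
  by rewrite mem_cube /= mem_zrange normr0.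
congr (_ + _); rewrite (bigID Z3pos) /= mulr2n mulrDl !mul1r; congr (_ + _).
  by apply: eq_bigl => n; case: eqP => [->|].
rewrite -(perm_big _ (cube_neg N)) big_map /=.
under eq_bigr do rewrite Fe.
apply: eq_bigl => n; case: (eqVneq n (0, 0, 0)) => [->|n0]; first by [].
have -> : Z3neg n != (0, 0, 0).
  by apply: contra n0 => /eqP h; rewrite -(Z3negK n) h.
rewrite Z3pos_neg ?Z3negK //.
by apply: contra n0 => /eqP h; rewrite -(Z3negK n) h.
Qed.

Lemma fdiff_cube_sum (R : realType) N l (F : nat -> Z3 -> R) i :
  'D^l (fun i => cube_sum N (F i)) i = cube_sum N (fun n => 'D^l (F ^~ n) i).
Proof.
elim: l i => [//|l IH] i; rewrite fdiffS !IH !cube_sumE -sumrB.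
by apply: eq_bigr.
Qed.

(** Both fields share one list because their joint expectation is computed. The imaginary parts at
    frequency 0 are absent: their coefficient [q] vanishes there. *)
Definition gauss_idx (N : nat) : seq (Z3 * nat) :=
  [:: ((0, 0, 0), 0%N); ((0, 0, 0), 2%N)] ++
  [seq (n, j) | n <- [seq n <- cube N | Z3pos n], j <- iota 0 4].

Lemma gauss_idx_uniq N : uniq (gauss_idx N).
Proof.
rewrite cat_uniq andbC -andbA allpairs_uniq ?filter_uniq ?cube_uniq //; last first.
  by move=> [? ?] [? ?].
rewrite andbT; apply/hasPn => -[n j]; rewrite mem_allpairs_pair mem_filter.
move=> /andP[/andP[n0 _] _]; rewrite !inE !xpair_eqE.
by case: eqP n0 => // ->.
Qed.

Lemma gauss_idx_sub N : {subset gauss_idx N <= indep_index}.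
Proof.
move=> [n j]; rewrite mem_cat mem_allpairs_pair mem_filter mem_iota !inE.
rewrite /indep_index /= !xpair_eqE => /orP[|/andP[/andP[-> _] ->]//].
by case/orP => /andP[-> ->]; rewrite ?orbT.
Qed.

Lemma sum_gauss_idx (R : realType) N (F : Z3 * nat -> R) :
  \sum_(i <- gauss_idx N) F i = F ((0, 0, 0), 0%N) + F ((0, 0, 0), 2%N) +
  \sum_(n <- cube N | Z3pos n) (F (n, 0%N) + F (n, 1%N) + F (n, 2%N) + F (n, 3%N)).
Proof.
rewrite big_cat; congr (_ + _); first by rewrite !big_cons big_nil /= addr0.
rewrite big_allpairs big_filter.
by apply: eq_bigr => n _; rewrite !big_cons big_nil /= addr0 !addrA.
Qed.

Definition gauss_sd (R : realType) (i : Z3 * nat) : R :=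
  if i.1 == (0, 0, 0) then 1 else Num.sqrt 2^-1.

(* Coefficient of the independent component [i] in the series with terms
   [(Re * p n - Im * q n) * W n], whose parts [Re], [Im] have second index [o], [o.+1]:
   the factor 2 accounts for the two frequencies [n] and [-n]. *)
Definition gauss_coef (R : realType) (o : nat) (p q W : Z3 -> R) (i : Z3 * nat) : R :=
  (if i.1 == (0, 0, 0) then 1 else 2) * W i.1 *
  (if i.2 == o then p i.1 else if i.2 == o.+1 then - q i.1 else 0).

Lemma gauss_coef_sum (R : realType) (Omega : Type) (a b c e : Z3 -> Omega -> R)
  (p q W : Z3 -> R) N (v : bool) (w : Omega) :
  let A := if v then c else a in let B := if v then e else b in
  (forall n, A (Z3neg n) w = A n w) -> (forall n, B (Z3neg n) w = - B n w) ->
  (forall n, p (Z3neg n) = p n) -> (forall n, q (Z3neg n) = - q n) ->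
  (forall n, W (Z3neg n) = W n) -> q (0, 0, 0) = 0 ->
  cube_sum N (fun n => (A n w * p n - B n w * q n) * W n) =
  \sum_(i <- gauss_idx N) gauss_coef (if v then 2 else 0) p q W i * gauss_family a b c e i w.
Proof.
move=> A B Ae Bo pe qo We q0.
rewrite cube_sum_even; last by move=> n; rewrite Ae Bo pe qo We mulrNN.
rewrite sum_gauss_idx q0 mulr0 subr0 mulr_sumr; congr (_ + _).
  by rewrite /gauss_coef /gauss_family /A; case: v A B Ae Bo => A B _ _ /=; ring.
rewrite big_seq_cond [RHS]big_seq_cond; apply: eq_bigr => n /andP[_ n0].
have nn0 : (n == (0, 0, 0)) = false by apply/eqP => h; rewrite h Z3pos0 in n0.
rewrite /gauss_coef /gauss_family /A /B /= nn0.
by case: v A B Ae Bo => A B _ _ /=; ring.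
Qed.

(** For a pair [n], [-n] the squared factor 2 times the variance 1/2 is 2, one unit per frequency:
    hence a sum over the full cube. *)
Lemma gauss_coef_var (R : realType) (p q W : Z3 -> R) N (v : bool) :
  (forall n, p (Z3neg n) = p n) -> (forall n, q (Z3neg n) = - q n) ->
  (forall n, W (Z3neg n) = W n) -> q (0, 0, 0) = 0 ->
  \sum_(i <- gauss_idx N) (gauss_coef (if v then 2 else 0) p q W i * gauss_sd R i) ^+ 2 =
  cube_sum N (fun n => W n ^+ 2 * (p n ^+ 2 + q n ^+ 2)).
Proof.
move=> pe qo We q0.
rewrite cube_sum_even; last by move=> n; rewrite pe qo We sqrrN.
rewrite sum_gauss_idx q0 expr0n /= addr0 mulr_sumr; congr (_ + _).
  by rewrite /gauss_coef /gauss_sd /=; case: v => /=; ring.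
rewrite big_seq_cond [RHS]big_seq_cond; apply: eq_bigr => n /andP[_ n0].
have nn0 : (n == (0, 0, 0)) = false by apply/eqP => h; rewrite h Z3pos0 in n0.
rewrite /gauss_coef /gauss_sd /= nn0.
have h2 : Num.sqrt 2^-1 ^+ 2 = 2^-1 :> R by rewrite sqr_sqrtr // invr_ge0.
rewrite !exprMn h2; case: v => /=; by field.
Qed.

(** * Convergence of the lattice sums *)

Lemma geometric_sum_bound (R : realType) (x : R) n : 0 <= x < 1 ->
  \sum_(j < n) x ^+ j <= (1 - x)^-1.
Proof.
move=> /andP[x0 x1]; have x1' : 0 < 1 - x by rewrite subr_gt0.
rewrite -[leRHS]mul1r ler_pdivlMr // mulrC.
have -> : (1 - x) * \sum_(j < n) x ^+ j = 1 - x ^+ n.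
  by rewrite -{2}(expr1n R n) subrXX; congr (_ * _); apply: eq_bigr => j _;
     rewrite expr1n mul1r.
by rewrite gerBl exprn_ge0.
Qed.

Lemma powR_expR_ln (R : realType) (x y : R) : 0 < x -> (x `^ y) = expR (y * ln x).
Proof. by move=> x0; rewrite /powR gt_eqF. Qed.

(** Cauchy condensation: the block of indices from [2^J] up to [2^(J+1)] contributes at most
    [2^J 2^(-J a) = x^J]. *)
Lemma riemann_sum_bound (R : realType) (a : R) : 1 < a ->
  exists K : R, forall n, \sum_(1 <= i < n) (i%:R `^ (- a)) <= K.
Proof.
move=> a1; pose x : R := 2 `^ (1 - a).
have x0 : 0 <= x by exact: powR_ge0.
have x1 : x < 1.
  have l2 : 0 < ln 2 :> R by rewrite ln_gt0 // ltr1n.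
  by rewrite /x powR_expR_ln // -[ltRHS]expR0 ltr_expR pmulr_llt0 // subr_lt0.
exists (1 - x)^-1 => n.
have dy J : \sum_(1 <= i < 2 ^ J) (i%:R `^ (- a)) <= \sum_(j < J) x ^+ j.
  elim: J => [|J IH]; first by rewrite expn0 big_geq // big_ord0.
  have p2 : (0 < 2 ^ J)%N by rewrite expn_gt0.
  rewrite (@big_cat_nat _ _ _ (2 ^ J)) //=; last by rewrite leq_exp2l.
  rewrite big_ord_recr /= lerD //.
  apply: (@le_trans _ _ (\sum_(2 ^ J <= i < 2 ^ J.+1) ((2 ^ J)%:R `^ (- a)))).
    rewrite big_nat_cond [leRHS]big_nat_cond; apply: ler_sum => i.
    rewrite andbT => /andP[i1 i2].
    rewrite !powRN lef_pV2 ?posrE ?powR_gt0 ?ltr0n ?(leq_trans p2) //.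
    by apply: ge0_ler_powR; rewrite ?nnegrE ?ler_nat //; lra.
  rewrite sumr_const_nat expnS mul2n -addnn addnK.
  rewrite -[leLHS]mulr_natl natrX.
  have -> : ((2 ^+ J) : R) * (2 ^+ J) `^ (- a) = x ^+ J.
    rewrite -{1}(powRr1 (exprn_ge0 J _)) // -powRD; last first.
      by apply/implyP => _; rewrite expf_neq0.
    rewrite -(powR_mulrn J (ler0n R 2)) -(powR_mulrn J x0) /x -!powRrM.
    by congr (_ `^ _); rewrite mulrC.
  by [].
have [->|n0] := eqVneq n 0%N; first by rewrite big_geq // invr_ge0 subr_ge0 ltW.
apply: (@le_trans _ _ (\sum_(1 <= i < 2 ^ n) (i%:R `^ (- a)))).
  rewrite [leRHS](@big_cat_nat _ _ _ n) //=; [|lia|exact/ltnW/ltn_expl].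
  by rewrite lerDl sumr_ge0 // => i _; exact: powR_ge0.
by apply: (le_trans (dy n)); apply: geometric_sum_bound; rewrite x0.
Qed.

Lemma zrange_sum_bound (R : realType) (g : int -> R) N :
  (forall z, 0 <= g z) -> (forall z, g (- z) = g z) ->
  \sum_(i < (N + N).+1) g (i%:Z - N%:Z) <= 2 * \sum_(0 <= i < N.+1) g i%:Z.
Proof.
move=> g0 ge; elim: N => [|N IH].
  rewrite big_ord_recl big_ord0 addr0 big_nat1 subrr.
  by have := g0 0; lra.
rewrite addSn addnS big_ord_recl big_ord_recr /= /bump /= big_nat_recr //=.
have -> : \sum_(i < (N + N).+1) g ((1 + i)%N%:Z - N.+1%:Z) =
    \sum_(i < (N + N).+1) g (i%:Z - N%:Z).
  by apply: eq_bigr => i _; congr g; lia.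
have -> : (1 + (N + N).+1)%N%:Z - N.+1%:Z = N.+1%:Z by lia.
have -> : 0%N%:Z - N.+1%:Z = - N.+1%:Z by lia.
rewrite ge; lra.
Qed.

Lemma jbr_sqr (R : realType) (n : Z3) :
  jbr R n ^+ 2 = 1 + (n.1.1)%:~R ^+ 2 + (n.1.2)%:~R ^+ 2 + (n.2)%:~R ^+ 2.
Proof. by rewrite sqr_sqrtr // !addr_ge0 ?sqr_ge0. Qed.

Lemma jbr_ge1 (R : realType) (n : Z3) : 1 <= jbr R n.
Proof.
by rewrite -(sqrtr1 R) ler_sqrt; rewrite -?addrA ?lerDl ?addr_ge0 ?sqr_ge0 ?ltr_pwDl.
Qed.

Lemma jbr_gt0 (R : realType) (n : Z3) : 0 < jbr R n.
Proof. exact: lt_le_trans (jbr_ge1 R n). Qed.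

Lemma jbr_neg (R : realType) (n : Z3) : jbr R (Z3neg n) = jbr R n.
Proof. by rewrite /jbr /= !mulrNz !sqrrN. Qed.

Lemma norm_fst_le_jbr (R : realType) (n : Z3) : `|(n.1.1)%:~R| <= jbr R n.
Proof.
rewrite -sqrtr_sqr ler_wsqrtr //.
have := sqr_ge0 ((n.1.2)%:~R : R); have := sqr_ge0 ((n.2)%:~R : R); lra.
Qed.

Lemma powR_sqr (R : realType) (x r : R) : 0 <= x -> (x ^+ 2) `^ r = x `^ (2 * r).
Proof. by move=> x0; rewrite powRrM -powR_mulrn. Qed.

(** The sixth power of [jbr] dominates the product of the three [1 + n_i^2], so the sum is bounded
    by a product of one-dimensional sums of [(1 + n_i^2)^(-p/6)], which converge because
    [p / 3 > 1]. *)
Lemma cube_sum_jbr_bound (R : realType) (p : R) : 3 < p ->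
  exists2 K : R, 0 <= K & forall N, cube_sum N (fun n => jbr R n `^ (- p)) <= K.
Proof.
move=> p3; pose g (z : int) : R := (1 + z%:~R ^+ 2) `^ (- (p / 6)).
have p60 : 0 <= p / 6 by lra.
have g0 z : 0 <= g z by exact: powR_ge0.
have gN z : g (- z) = g z by rewrite /g mulrNz sqrrN.
have sp (z : int) : 1 <= 1 + z%:~R ^+ 2 :> R by rewrite lerDl sqr_ge0.
have sp0 (z : int) : 0 < 1 + z%:~R ^+ 2 :> R by apply: lt_le_trans (sp z).
have hg n : jbr R n `^ (- p) <= g n.1.1 * g n.1.2 * g n.2.
  rewrite /g -!powRM ?mulr_ge0 ?(ltW (sp0 _)) //.
  have -> : jbr R n `^ (- p) = ((jbr R n ^+ 2) ^+ 3) `^ (- (p / 6)).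
    rewrite -!exprM -powR_mulrn ?(ltW (jbr_gt0 _ _)) // -powRrM; congr (_ `^ _).
    by field.
  have j0' : 0 < jbr R n := jbr_gt0 R n.
  have j0 : 0 <= jbr R n := ltW (jbr_gt0 R n).
  have j20 : 0 < jbr R n ^+ 2 by rewrite exprn_gt0 ?jbr_gt0.
  rewrite !powRN lef_pV2 ?posrE ?powR_gt0 ?mulr_gt0 ?exprn_gt0 //.
  apply: ge0_ler_powR => //; rewrite ?nnegrE ?mulr_ge0 ?exprn_ge0 ?(ltW (sp0 _)) ?(ltW j20) //.
  have -> : (jbr R n ^+ 2) ^+ 3 = jbr R n ^+ 2 * jbr R n ^+ 2 * jbr R n ^+ 2 by ring.
  rewrite jbr_sqr.
  have h1 := sqr_ge0 ((n.1.1)%:~R : R); have h2 := sqr_ge0 ((n.1.2)%:~R : R).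
  have h3 := sqr_ge0 ((n.2)%:~R : R).
  have h0 z := ltW (sp0 z).
  by apply: ler_pM; [exact: mulr_ge0|exact: h0|apply: ler_pM => //; lra|lra].
have p31 : 1 < p / 3 by lra.
have [K hK] := riemann_sum_bound p31.
pose K1 := 2 * (1 + K).
have hK1 N : \sum_(i < (N + N).+1) g (i%:Z - N%:Z) <= K1.
  apply: (le_trans (zrange_sum_bound _ g0 gN)); rewrite ler_pM2l //.
  rewrite big_nat_recl // lerD //; first by rewrite /g expr0n /= addr0 powR1.
  apply: le_trans (hK N.+1); rewrite big_add1 /=; apply: ler_sum => i _.
  rewrite /g (_ : - (p / 3) = 2 * (- (p / 6))); last by field.
  rewrite -powR_sqr // !powRN lef_pV2 ?posrE ?powR_gt0 ?exprn_gt0 //.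
  apply: ge0_ler_powR => //; rewrite ?nnegrE ?exprn_ge0 ?(ltW (sp0 _)) //.
  by rewrite lerDr.
have S0 N : 0 <= \sum_(i < (N + N).+1) g (i%:Z - N%:Z) by rewrite sumr_ge0.
have K10 : 0 <= K1 := le_trans (S0 0%N) (hK1 0%N).
exists (K1 * K1 * K1); first by apply: mulr_ge0 => //; apply: mulr_ge0.
move=> N; apply: (le_trans (ler_cube_sum N hg)).
rewrite /cube_sum /=; set S := \sum_(i < (N + N).+1) g (i%:Z - N%:Z).
have -> : \sum_(i < (N + N).+1) \sum_(j < (N + N).+1) \sum_(l < (N + N).+1)
   g (i%:Z - N%:Z) * g (j%:Z - N%:Z) * g (l%:Z - N%:Z) = S * S * S.
  rewrite -[S * S * S]mulrA mulr_suml; apply: eq_bigr => i _.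
  rewrite mulr_suml mulr_sumr; apply: eq_bigr => j _.
  by rewrite !mulr_sumr; apply: eq_bigr => l _; rewrite mulrA.
have hS := hK1 N; have S0N : 0 <= S := S0 N.
by apply: ler_pM => //; [exact: mulr_ge0|apply: ler_pM].
Qed.

(** * Variance of the finite differences *)

Lemma chord_sqr_le (R : realType) (x : R) : 2 - 2 * cos x <= 2 * x ^+ 2.
Proof.
wlog x0 : x / 0 <= x.
  by move=> H; rewrite -cos_norm -(real_normK (num_real x)); exact: H.
have [y /andP[y0 yx]] := @mean_value R cos (fun x => - sin x) 0 x x0 (@is_derive_cos R).
have [z /andP[z0 zy]] := @mean_value R sin cos 0 y y0 (@is_derive_sin R).
rewrite sin0 cos0 !subr0 => hs hc.
have h1 : sin y <= x.
  rewrite hs (le_trans _ yx) // -[leRHS]mul1r ler_wpM2r //; exact: cos_le1.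
have := ler_wpM2r x0 h1; rewrite expr2; lra.
Qed.

(** The chord [|e^(ix) - 1|^2] is at most 4 and at most [4 x^2]; interpolating gives every power
    [2 b] with [b <= l], which is how fractional regularity is read off. *)
Lemma chord_exp_bound (R : realType) (x b : R) l : 0 <= b <= l%:R ->
  (2 - 2 * cos x) ^+ l <= 4 ^+ l * `|x| `^ (2 * b).
Proof.
move=> /andP[b0 bl].
have c0 : 0 <= 2 - 2 * cos x by have := cos_le1 x; lra.
have [x1|x1] := leP 1 `|x|.
  apply: (@le_trans _ _ (4 ^+ l)).
    by rewrite lerXn2r ?nnegrE //; have := cos_geN1 x; lra.
  rewrite ler_peMr ?exprn_ge0 //.
  by rewrite -[leLHS](powRr0 `|x|) ler_powR // mulr_ge0.
have [->|x0] := eqVneq x 0.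
  rewrite cos0 mulr1 subrr normr0.
  (* For [l = 0] also [b = 0], and both sides are 1, zero to the power zero being 1. *)
  case: l bl => [|l] bl; last first.
    by rewrite expr0n /= mulr_ge0 ?exprn_ge0 ?powR_ge0.
  have -> : b = 0 by apply/eqP; rewrite eq_le bl.
  by rewrite !expr0 mulr0 powRr0 mulr1.
apply: (@le_trans _ _ ((4 * x ^+ 2) ^+ l)).
  have h2 := sqr_ge0 x.
  have h4 : 2 - 2 * cos x <= 4 * x ^+ 2 by have := chord_sqr_le x; lra.
  by rewrite lerXn2r ?nnegrE // (le_trans c0).
rewrite exprMn ler_wpM2l ?exprn_ge0 // -(real_normK (num_real x)) -exprM.
rewrite -powR_mulrn // natrM ger_powR ?ler_wpM2l //.
by rewrite normr_gt0 x0 ltW.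
Qed.

Definition gpt (R : realType) (h : R) (i : nat) : pt3 R := (i%:R * h, 0, 0).

Definition dcos (R : realType) (h : R) l i (n : Z3) : R :=
  'D^l (fun i => cos (dotZ3 n (gpt h i))) i.

Definition dsin (R : realType) (h : R) l i (n : Z3) : R :=
  'D^l (fun i => sin (dotZ3 n (gpt h i))) i.

Lemma dcos_neg (R : realType) (h : R) l i n : dcos h l i (Z3neg n) = dcos h l i n.
Proof.
rewrite /dcos; congr ('D^_ _ _); apply/funext => p.
by rewrite -cosN /dotZ3 /= !mulrNz; congr cos; ring.
Qed.

Lemma dsin_neg (R : realType) (h : R) l i n : dsin h l i (Z3neg n) = - dsin h l i n.
Proof.
rewrite /dsin -fdiffN; congr ('D^_ _ _); apply/funext => p.
by rewrite -sinN /dotZ3 /= !mulrNz; congr sin; ring.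
Qed.

Lemma dsin0 (R : realType) (h : R) l i : dsin h l i (0, 0, 0) = 0.
Proof.
have := dsin_neg h l i (0, 0, 0); rewrite -[Z3neg _]/(0, 0, 0); lra.
Qed.

(** [dcos + i dsin] is [e^(i n.x) (e^(it) - 1)^l], whose modulus does not depend on the base point.
    In real terms a unit shift is a rotation by [t]: these are [rc] and [rs]. *)
Lemma dcos_dsin_sqr (R : realType) (h : R) l i n :
  dcos h l i n ^+ 2 + dsin h l i n ^+ 2 = (2 - 2 * cos (n.1.1%:~R * h)) ^+ l.
Proof.
set t := n.1.1%:~R * h.
have dS p : dotZ3 n (gpt h p.+1) = dotZ3 n (gpt h p) + t.
  by rewrite /dotZ3 /gpt /t /= -natr1; ring.
elim: l i => [|l IH] i; first by rewrite /dcos /dsin /= cos2Dsin2 expr0.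
have rc : dcos h l i.+1 n = cos t * dcos h l i n - sin t * dsin h l i n.
  rewrite /dcos /dsin -fdiff_shift -!fdiffZ -fdiffN -fdiffD.
  by congr ('D^_ _ _); apply/funext => p; rewrite dS cosD; ring.
have rs : dsin h l i.+1 n = sin t * dcos h l i n + cos t * dsin h l i n.
  rewrite /dcos /dsin -fdiff_shift -!fdiffZ -fdiffD.
  by congr ('D^_ _ _); apply/funext => p; rewrite dS sinD; ring.
rewrite [RHS]exprS -(IH i) {1}/dcos {1}/dsin !fdiffS -/(dcos _ _ _ _) -/(dcos _ _ _ _).
rewrite -/(dsin _ _ _ _) -/(dsin _ _ _ _) rc rs.
have := cos2Dsin2 t; move: (cos t) (sin t) (dcos h l i n) (dsin h l i n) => x y p q e.
have -> : 2 - 2 * x = (x - 1) ^+ 2 + y ^+ 2 by rewrite !expr2 in e *; lra.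
by ring.
Qed.

Lemma spectral_term_ge0 (R : realType) (r h : R) l (n : Z3) :
  0 <= ((jbr R n `^ r)^-1) ^+ 2 * (2 - 2 * cos (n.1.1%:~R * h)) ^+ l.
Proof.
rewrite mulr_ge0 ?sqr_ge0 // exprn_ge0 //.
Qed.

(** [|n_1 h|^(2b) <= h^(2b) <n>^(2b)] trades decay in [n] for a power of the mesh, and what is left
    converges since [2 r - 2 b > 3]. With [r = s] this allows [b < g], with [r = s + 1] it allows
    [b < g + 1], as long as [b <= l]. *)
Lemma spectral_upper (R : realType) (r b : R) l : 0 <= b <= l%:R -> 3 < 2 * r - 2 * b ->
  exists2 K : R, 0 <= K & forall h N, 0 < h ->
  cube_sum N (fun n => ((jbr R n `^ r)^-1) ^+ 2 * (2 - 2 * cos (n.1.1%:~R * h)) ^+ l)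
    <= K * h `^ (2 * b).
Proof.
move=> bl rb; have [K K0 HK] := cube_sum_jbr_bound rb.
exists (4 ^+ l * K); first by rewrite mulr_ge0 ?exprn_ge0.
move=> h N h0.
have hh : 0 <= 4 ^+ l * h `^ (2 * b) by rewrite mulr_ge0 ?exprn_ge0 ?powR_ge0.
rewrite -mulrA [K * _]mulrC mulrA.
apply: le_trans (ler_wpM2l hh (HK N)).
rewrite !cube_sumE mulr_sumr; apply: ler_sum => n _.
have j0 := jbr_gt0 R n; have b0 : 0 <= 2 * b by case/andP: bl => *; lra.
have -> : jbr R n `^ (- (2 * r - 2 * b)) =
    ((jbr R n `^ r)^-1) ^+ 2 * jbr R n `^ (2 * b).
  rewrite -powRN -powR_mulrn ?powR_ge0 // -powRrM -powRD.
    by congr (_ `^ _); ring.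
  by apply/implyP => _; rewrite gt_eqF.
rewrite mulrCA ler_wpM2l ?sqr_ge0 //.
apply: (le_trans (chord_exp_bound _ bl)); rewrite -mulrA ler_wpM2l ?exprn_ge0 //.
rewrite normrM (gtr0_norm h0) powRM ?(ltW h0) // [leLHS]mulrC ler_wpM2l ?powR_ge0 //.
by apply: ge0_ler_powR => //; rewrite ?nnegrE ?(ltW j0) // norm_fst_le_jbr.
Qed.

Lemma ler_sum_subseq (R : realType) (I : eqType) (s t : seq I) (F : I -> R) :
  uniq s -> uniq t -> {subset s <= t} -> (forall i, 0 <= F i) ->
  \sum_(i <- s) F i <= \sum_(i <- t) F i.
Proof.
move=> us ut st F0; rewrite [leRHS](bigID (mem s)) /= -[X in _ <= X + _]big_filter.
rewrite (@perm_big _ _ _ _ [seq i <- t | i \in s] s) ?lerDl ?sumr_ge0 //.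
apply: uniq_perm => //; first exact: filter_uniq.
by move=> i; rewrite mem_filter; case: (boolP (i \in s)) => // /st ->.
Qed.

(** On this block [n_1 / H] lies in [1, 2), away from the zeros of [2 - 2 cos], and [jbr] is at most
    [4 H]. *)
Definition zbox (H : nat) : seq Z3 :=
  [seq (p, z) | p <- [seq (x, y) | x <- [seq i%:Z | i <- iota H H],
    y <- [seq i%:Z | i <- iota H H]], z <- [seq i%:Z | i <- iota H H]].

Lemma mem_zbox H (n : Z3) : n \in zbox H ->
  [/\ (H%:Z <= n.1.1 < 2 * H%:Z)%R, (H%:Z <= n.1.2 < 2 * H%:Z)%R & (H%:Z <= n.2 < 2 * H%:Z)%R].
Proof.
have mi z : z \in [seq i%:Z | i <- iota H H] -> (H%:Z <= z < 2 * H%:Z)%R.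
  by move=> /mapP[i]; rewrite mem_iota => h ->; lia.
case: n => [[x y] z]; rewrite !mem_allpairs_pair => /andP[/andP[/mi ? /mi ?] /mi ?].
by split.
Qed.

Lemma zbox_uniq H : uniq (zbox H).
Proof.
have u : uniq [seq i%:Z | i <- iota H H] by rewrite map_inj_uniq ?iota_uniq // => i j; lia.
rewrite allpairs_uniq //; last by move=> [? ?] [? ?].
by rewrite allpairs_uniq // => [[? ?] [? ?]].
Qed.

(* The cubes [H, 2H)^3 with [H = 1 / h] already carry the full order of the variance. *)
Lemma spectral_lower (R : realType) (r : R) m : 0 <= r ->
  exists2 c : R, 0 < c & forall (H N : nat), (0 < H)%N -> (2 * H <= N)%N ->
  c * (H%:R^-1) `^ (2 * r - 3) <=
  cube_sum N (fun n => ((jbr R n `^ r)^-1) ^+ 2 *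
                       (2 - 2 * cos (n.1.1%:~R * H%:R^-1)) ^+ m).
Proof.
move=> r0.
have pi2 : 2 <= pi :> R := pi_ge2 R.
have c1 : cos 1 < 1 :> R.
  by rewrite -[ltRHS]cos0 ltr_cos ?in_itv /= ?ltr01 //; lra.
(* As [cos] decreases on [0, pi] and [2 <= pi], this bounds the chord factor from below on
   [1, 2]. *)
pose c0 : R := 2 - 2 * cos 1; have c00 : 0 < c0 by rewrite /c0; lra.
exists (4 `^ (- (2 * r)) * c0 ^+ m); first by rewrite mulr_gt0 ?powR_gt0 ?exprn_gt0.
move=> H N H0 HN.
have HR : 0 < H%:R :> R by rewrite ltr0n.
rewrite cube_sumE.
apply: (@le_trans _ _ (\sum_(n <- zbox H)
   ((jbr R n `^ r)^-1) ^+ 2 * (2 - 2 * cos (n.1.1%:~R * H%:R^-1)) ^+ m)); last first.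
  have st : {subset zbox H <= cube N}.
    move=> n /mem_zbox[h1 h2 h3]; rewrite mem_cube !mem_zrange.
    clear -HN h1 h2 h3; lia.
  apply: ler_sum_subseq; rewrite ?zbox_uniq ?cube_uniq // => n.
  exact: spectral_term_ge0.
have hterm n : n \in zbox H -> (4 * H%:R) `^ (- (2 * r)) * c0 ^+ m <=
    ((jbr R n `^ r)^-1) ^+ 2 * (2 - 2 * cos (n.1.1%:~R * H%:R^-1)) ^+ m.
  move=> /mem_zbox[h1 h2 h3].
  have j0 := jbr_gt0 R n.
  have bd (z : int) : (H%:Z <= z < 2 * H%:Z)%R -> H%:R <= (z%:~R : R) < 2 * H%:R.
    move=> /andP[z1 z2]; apply/andP; split; first by move: z1; rewrite -(ler_int R).
    have -> : 2 * H%:R = ((2 * H)%N%:Z)%:~R :> R by rewrite -pmulrn natrM.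
    by rewrite ltr_int; clear -z2; lia.
  have /andP[a1 a2] := bd _ h1; have /andP[b1 b2] := bd _ h2.
  have /andP[d1 d2] := bd _ h3.
  apply: ler_pM; rewrite ?powR_ge0 ?exprn_ge0 ?(ltW c00) //.
    rewrite -powRN -powR_mulrn ?powR_ge0 // -powRrM (_ : - r * 2 = - (2 * r)); last by ring.
    rewrite !powRN lef_pV2 ?posrE ?powR_gt0 ?mulr_gt0 //.
    apply: ge0_ler_powR; rewrite ?nnegrE ?mulr_ge0 ?(ltW j0) ?(ltW HR) //.
    rewrite -(ler_pXn2r (n := 2)) ?nnegrE ?mulr_ge0 ?(ltW j0) ?(ltW HR) // jbr_sqr.
    have H1 : 1 <= H%:R :> R by rewrite ler1n.
    have sq (x : R) : H%:R <= x < 2 * H%:R -> x ^+ 2 <= 4 * H%:R ^+ 2.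
      move=> /andP[x1 x2]; rewrite (_ : 4 * _ = (2 * H%:R) ^+ 2); last by ring.
      by rewrite lerXn2r ?nnegrE ?mulr_ge0 //; lra.
    have := sq _ (bd _ h1); have := sq _ (bd _ h2); have := sq _ (bd _ h3).
    have : 1 <= H%:R ^+ 2 :> R by rewrite exprn_ege1.
    rewrite exprMn; lra.
  have t1 : 1 <= n.1.1%:~R / H%:R :> R by rewrite ler_pdivlMr // mul1r.
  have t2 : n.1.1%:~R / H%:R <= 2 :> R by rewrite ler_pdivrMr // ltW.
  rewrite lerXn2r ?nnegrE ?(ltW c00) //.
  rewrite /c0 lerD2l lerN2 ler_pM2l //.
  rewrite leNgt ltr_cos ?in_itv /= -?leNgt //; apply/andP; split; lra.
rewrite big_seq.
apply: (@le_trans _ _ (\sum_(n <- zbox H | n \in zbox H)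
   (4 * H%:R) `^ (- (2 * r)) * c0 ^+ m)); last by apply: ler_sum => n; exact: hterm.
rewrite -big_seq big_const_seq count_predT iter_addr addr0.
(* The [H^3] points turn the size [H^(-2r)] of one term into [h^(2r - 3)]. *)
have -> : size (zbox H) = (H * H * H)%N by rewrite !size_allpairs !size_map !size_iota.
rewrite -[leRHS]mulr_natr powRM ?(ltW HR) //.
have -> : (H%:R^-1) `^ (2 * r - 3) = H%:R `^ (- (2 * r)) * (H * H * H)%:R :> R.
  rewrite -powR_inv1 ?(ltW HR) // -powRrM.
  have -> : (H * H * H)%:R = H%:R `^ 3 :> R.
    by rewrite (powR_mulrn 3) ?(ltW HR) // !natrM !exprS expr0; ring.
  rewrite -powRD; last by apply/implyP => _; rewrite gt_eqF.
  by congr (_ `^ _); ring.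
by rewrite le_eqVlt; apply/orP; left; apply/eqP; ring.
Qed.

(** * Gaussian vectors *)

Lemma integral_normal_prob (R : realType) (m sg : R) (f : R -> \bar R) :
  (normal_prob m sg).-integrable setT f ->
  (\int[normal_prob m sg]_x f x =
   \int[lebesgue_measure]_x (f x * (normal_pdf m sg x)%:E))%E.
Proof.
move=> fi; have dom := normal_prob_dominates m sg.
rewrite -(Radon_Nikodym_change_of_variables dom) //.
have mf := measurable_int _ fi.
have mp := measurable_int _ (integrable_normal_pdf m sg).
apply: ae_eq_integral => //; [exact: emeasurable_funM | exact: emeasurable_funM |].
apply: ae_eqe_mul2l; apply: integral_ae_eq => //.
  exact: Radon_Nikodym_integrable.
by move=> E _ mE; rewrite -Radon_Nikodym_integral.
Qed.

(** This is [E exp(-l Y^2)] for a centred Gaussian [Y] of variance [V]. *)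
Definition gfactor (R : realType) (l V : R) : R := (Num.sqrt (1 + 2 * l * V))^-1.

Lemma measurable_expR_sqr (R : realType) (l y al : R) :
  measurable_fun setT (fun x : R => expR (- (l * (y + al * x) ^+ 2))).
Proof.
apply: measurableT_comp => //; apply: measurableT_comp => //.
apply: measurable_funM => //; apply: measurable_funX.
by apply: measurable_funD => //; apply: measurable_funM.
Qed.

Lemma expR_sqr_le1 (R : realType) (l y : R) : 0 <= l -> expR (- (l * y ^+ 2)) <= 1.
Proof. by move=> l0; rewrite -expR0 ler_expR oppr_le0 mulr_ge0 ?sqr_ge0. Qed.

Lemma integral_normal_expR_sqr (R : realType) (sg l y al : R) : 0 < sg -> 0 <= l ->
  let V := 1 + 2 * l * (al * sg) ^+ 2 in
  (\int[normal_prob 0 sg]_x (expR (- (l * (y + al * x) ^+ 2)))%:E =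
   (gfactor l ((al * sg) ^+ 2) * expR (- (l / V * y ^+ 2)))%:E)%E.
Proof.
move=> sg0 l0 V.
have V1 : 1 <= V.
  by rewrite lerDl; apply: mulr_ge0; [apply: mulr_ge0 | exact: sqr_ge0].
have V0 : 0 < V by lra.
have sV0 : 0 < Num.sqrt V by rewrite sqrtr_gt0.
rewrite integral_normal_prob; last first.
  apply/integrableP; split.
    by apply/measurable_EFinP; exact: measurable_expR_sqr.
  apply: (@le_lt_trans _ _ (\int[normal_prob 0 sg]_x (cst 1%E) x)%E).
    apply: ge0_le_integral => //.
    - apply/measurable_EFinP; apply: measurableT_comp => //.
      exact: measurable_expR_sqr.
    - by move=> x _; rewrite /= ger0_norm ?expR_ge0 // lee_fin expR_sqr_le1.
  rewrite integral_cst // mul1e; apply: (@le_lt_trans _ _ 1%E); last exact: ltry.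
  exact: probability_le1.
(* Completing the square: the exponential times the normal density is a multiple of the normal
   density with mean [m'] and deviation [sg']. *)
pose sg' := sg / Num.sqrt V.
pose m' := - (2 * l * al * y * sg ^+ 2 / V).
have sg'0 : 0 < sg' by rewrite divr_gt0.
have sg'2 : sg' ^+ 2 = sg ^+ 2 / V by rewrite expr_div_n sqr_sqrtr // ltW.
rewrite /gfactor -/V; set c := _ * expR _.
have c0 : 0 <= c by rewrite mulr_ge0 ?expR_ge0 // invr_ge0 sqrtr_ge0.
have key x : expR (- (l * (y + al * x) ^+ 2)) * normal_pdf 0 sg x =
    c * normal_pdf m' sg' x.
  rewrite !normal_pdfE ?gt_eqF //= /normal_fun subr0.
  have -> : normal_peak sg' = Num.sqrt V * normal_peak sg.
    rewrite /normal_peak sg'2.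
    have -> : sg ^+ 2 / V * pi *+ 2 = (V^-1 : R) * (sg ^+ 2 * pi *+ 2).
      by move: (sg ^+ 2) V^-1 (pi : R) => p q r; ring.
    rewrite sqrtrM ?invr_ge0 1?ltW // invfM; congr (_ * _).
    by rewrite sqrtrV ?invrK // ltW.
  rewrite /c; set A := normal_peak sg.
  rewrite mulrCA -expRD.
  set E1 := expR (- (l / V * _)); set E2 := expR (- (x - m') ^+ 2 / _).
  have -> : (Num.sqrt V)^-1 * E1 * (Num.sqrt V * A * E2) = A * (E1 * E2).
    move: E1 E2 A (Num.sqrt V) sV0 => e1 e2 a v v0.
    by field; rewrite gt_eqF.
  rewrite /E1 /E2 -expRD; congr (_ * expR _).
  rewrite sg'2 /m'.
  have Vn0 : V != 0 by rewrite gt_eqF.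
  have sgn0 : sg != 0 by rewrite gt_eqF.
  move: Vn0; rewrite /V => Vn0; clear -Vn0 sgn0.
  by field; rewrite Vn0 sgn0.
under eq_integral do rewrite -EFinM key EFinM.
rewrite ge0_integralZl_EFin //.
- by rewrite integral_normal_pdf mule1.
- by move=> x _; rewrite lee_fin normal_pdf_ge0.
- by apply/measurable_EFinP; exact: measurable_normal_pdf.
Qed.

(** The hypothesis identifies the joint law of [Z] and [X] on rectangles, hence everywhere, with the
    product of the law of [Z] and [nu]; the rest is Tonelli. *)
Lemma indep_fubini (R : realType) (d d' : measure_display) (Omega : measurableType d)
  (P : probability Omega R) (T : measurableType d')
  (Z : {mfun Omega >-> T}) (X : {mfun Omega >-> measurableTypeR R})
  (nu : probability (measurableTypeR R) R) (F : T * measurableTypeR R -> \bar R) :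
  (forall A B, measurable A -> measurable B ->
     P (Z @^-1` A `&` X @^-1` B) = P (Z @^-1` A) * nu B)%E ->
  measurable_fun setT F -> (forall z, 0 <= F z)%E ->
  (\int[P]_w F (Z w, X w) = \int[P]_w \int[nu]_x F (Z w, x))%E.
Proof.
move=> ind mF F0.
have mZX : measurable_fun setT (fun w => (Z w, X w)) by exact: measurable_fun_pair.
pose ZX : {mfun Omega >-> (T * measurableTypeR R)%type} :=
  HB.pack (fun w => (Z w, X w)) (isMeasurableFun.Build _ _ _ _ _ mZX).
transitivity (\int[distribution P ZX]_z F z)%E.
  by rewrite ge0_integral_distribution.
transitivity (\int[(distribution P Z \x nu)%E]_z F z)%E.
  apply: eq_measure_integral => A mA _.
  by apply/esym/product_measure_unique => // B C mB mC; rewrite -ind.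
rewrite (fubini_tonelli1 _ mF F0) ge0_integral_distribution //.
- exact: measurable_fun_fubini_tonelli_F.
- by move=> z; apply: integral_ge0.
Qed.

(** Independence is given on finite intersections only. These form the pi-system [G], on which the
    finite measures [P (E & F)] and [P F . P E], as functions of [E], agree; so they agree on the
    generated sigma-algebra. *)
Lemma indep_event (R : realType) (d : measure_display) (Omega : measurableType d)
  (P : probability Omega R) (I : choiceType) (J : set I) (X : I -> Omega -> R)
  (i : I) (S : seq I) (B : set R) :
  mutually_independent P J X -> uniq (i :: S) -> {subset i :: S <= J} ->
  (forall j, j \in i :: S -> measurable_fun setT (X j)) -> measurable B ->
  forall E : set Omega,
  <<s [set E | exists2 C : I -> set R, forall j, measurable (C j) &
        E = \bigcap_(j in [set j | j \in S]) (X j @^-1` C j)] >> E ->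
  (P (E `&` X i @^-1` B) = P E * P (X i @^-1` B))%E.
Proof.
move=> ind /= /andP[iS uS] sJ mX mB; set G := [set E | _].
set F := X i @^-1` B.
have mF : measurable F.
  by rewrite -[F]setTI; apply: mX => //; rewrite inE eqxx.
have mG : G `<=` measurable.
  move=> _ [C mC ->]; apply: fin_bigcap_measurable => [|j jS]; first exact: finite_seq.
  by rewrite -[_ @^-1` _]setTI; apply: mX => //; rewrite inE jS orbT.
have GT : G setT.
  by exists (fun=> setT) => //; rewrite bigcapT.
have GI : setI_closed G.
  move=> _ _ [C1 mC1 ->] [C2 mC2 ->]; exists (fun j => C1 j `&` C2 j).
    by move=> j; exact: measurableI.
  by rewrite -bigcapI.
have fF : P F \is a fin_num by rewrite fin_num_measure.
pose r := NngNum (fine_ge0 (measure_ge0 P F)).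
have rE : (r%:num%:E = P F)%E by rewrite /= fineK.
pose m1 : {measure set Omega -> \bar R} := mrestr P mF.
pose m2 : {measure set Omega -> \bar R} := mscale r P.
have m12 A : G A -> m1 A = m2 A.
  move=> [C mC ->]; set A1 := (X in m1 X).
  rewrite -[m1 A1]/(P (A1 `&` F)) -[m2 A1]/(r%:num%:E * P A1)%E rE /A1 {A1}.
  have h1 := ind (i :: S) _ sJ (fun j => if j == i then B else C j).
  have h2 := ind S uS _ C.
  have Si j : j \in S -> (j == i) = false.
    by move=> jS; apply/eqP => ji; move: iS; rewrite -ji jS.
  have e : \bigcap_(j in [set j | j \in S]) X j @^-1` C j `&` F =
     \bigcap_(j in [set j | j \in i :: S]) (X j @^-1` (if j == i then B else C j)).
    apply/seteqP; split => w /=.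
      move=> [h Fw] j /=; rewrite inE => /orP[/eqP ->|jS]; first by rewrite eqxx.
      by rewrite (Si _ jS); exact: h.
    move=> h; split; first by move=> j /= jS; have := h j; rewrite /= inE jS orbT Si //; exact.
    by have := h i; rewrite /= inE eqxx; exact.
  rewrite e h1 /=; last 2 first.
  - by rewrite iS.
  - by move=> j _; case: ifP.
  rewrite big_cons eqxx h2 //; last by move=> j jS; apply: sJ; rewrite inE jS orbT.
  congr (_ * _)%E; rewrite big_seq [RHS]big_seq; apply: eq_bigr => j jS.
  by rewrite Si.
move=> E GE; rewrite muleC -rE.
apply: (@g_sigma_algebra_measure_unique _ _ _ G mG (fun=> setT) (fun=> GT) _ m1 m2) => //.
  by rewrite bigcup_const.
by move=> _; rewrite /m1 /= /mrestr setTI ltey_eq fin_num_measure.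
Qed.

Lemma gfactor0 (R : realType) (l : R) : gfactor l 0 = 1.
Proof. by rewrite /gfactor mulr0 addr0 sqrtr1 invr1. Qed.

Lemma gfactor_ge0 (R : realType) (l V : R) : 0 <= gfactor l V.
Proof. by rewrite invr_ge0 sqrtr_ge0. Qed.

(** The radicands multiply: [(1 + 2 l V) (1 + 2 l' W) = 1 + 2 l (V + W)] for [l' = l / (1 + 2 l V)].
    Integrating out terms in turn therefore adds their variances. *)
Lemma gfactorD (R : realType) (l V W : R) : 0 <= l -> 0 <= V ->
  gfactor l V * gfactor (l / (1 + 2 * l * V)) W = gfactor l (V + W).
Proof.
move=> l0 V0; rewrite /gfactor -invfM.
have V1 : 0 < 1 + 2 * l * V.
  by rewrite ltr_pwDl // mulr_ge0 // mulr_ge0.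
rewrite -sqrtrM ?(ltW V1) //; congr (Num.sqrt _)^-1.
by field; rewrite gt_eqF.
Qed.

(** [al * be = 0] says that the variable enters only one of the two squares; by symmetry it is the
    first, and the other factor is constant. *)
Lemma integral_normal_expR_sqr2 (R : realType) (sg l m y z al be : R) :
  0 < sg -> 0 <= l -> 0 <= m -> al * be = 0 ->
  (\int[normal_prob 0 sg]_x
     (expR (- (l * (y + al * x) ^+ 2)) * expR (- (m * (z + be * x) ^+ 2)))%:E =
   (gfactor l ((al * sg) ^+ 2) * gfactor m ((be * sg) ^+ 2) *
     (expR (- (l / (1 + 2 * l * (al * sg) ^+ 2) * y ^+ 2)) *
      expR (- (m / (1 + 2 * m * (be * sg) ^+ 2) * z ^+ 2))))%:E)%E.
Proof.
wlog : l m y z al be / be = 0.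
  move=> H sg0 l0 m0 ab; have /eqP := ab; rewrite mulf_eq0 => /orP[] /eqP h.
    have := H m l z y be al h sg0 m0 l0; rewrite mulrC ab => /(_ erefl).
    under eq_integral do rewrite mulrC.
    move=> ->; congr (_%:E); ring.
  exact: H.
move=> -> sg0 l0 m0 _.
under eq_integral => x _ do rewrite [0 * _]mul0r addr0 mulrC EFinM.
rewrite ge0_integralZl_EFin ?expR_ge0 //; last first.
  by apply/measurable_EFinP; exact: measurable_expR_sqr.
rewrite integral_normal_expR_sqr // -EFinM !mul0r expr0n /= gfactor0 mulr0 addr0.
by rewrite divr1; congr (_%:E); ring.
Qed.

Lemma measurable_sum_in (R : realType) (d : measure_display) (T : measurableType d)
  (I : choiceType) (S : seq I) (h : I -> T -> R) :
  (forall j, j \in S -> measurable_fun setT (h j)) ->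
  measurable_fun setT (fun w => \sum_(j <- S) h j w).
Proof.
elim: S => [|i S IH] mh.
  by under eq_fun do rewrite big_nil; exact: measurable_cst.
under eq_fun do rewrite big_cons.
apply: measurable_funD; first by apply: mh; rewrite inE eqxx.
by apply: IH => j jS; apply: mh; rewrite inE jS orbT.
Qed.

(* Independent Gaussians are integrated out one at a time; each integration replaces
   [l] by [l / (1 + 2 l V)], [V] being the variance of the term removed. *)
Lemma expectation_expR_sqr (R : realType) (d : measure_display) (Omega : measurableType d)
  (P : probability Omega R) (I : choiceType) (J : set I) (X : I -> Omega -> R)
  (sg al be : I -> R) (S : seq I) :
  mutually_independent P J X -> uniq S -> {subset S <= J} ->
  (forall j, j \in S -> 0 < sg j /\ is_centered_normal P (sg j) (X j)) ->
  (forall j, al j * be j = 0) ->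
  forall l m : R, 0 <= l -> 0 <= m ->
  (\int[P]_w (expR (- (l * (\sum_(j <- S) al j * X j w) ^+ 2)) *
              expR (- (m * (\sum_(j <- S) be j * X j w) ^+ 2)))%:E =
   (gfactor l (\sum_(j <- S) (al j * sg j) ^+ 2) *
    gfactor m (\sum_(j <- S) (be j * sg j) ^+ 2))%:E)%E.
Proof.
move=> ind + + + ab; elim: S => [|i S IH] uS sJ hX l m l0 m0.
  under eq_integral do rewrite !big_nil expr0n /= !mulr0 oppr0 expR0 mulr1.
  by rewrite integral_cst //= probability_setT mule1 !big_nil !gfactor0 mulr1.
have [iS uS'] := andP uS.
have sJ' : {subset S <= J} by move=> j jS; apply: sJ; rewrite inE jS orbT.
have hX' j : j \in S -> 0 < sg j /\ is_centered_normal P (sg j) (X j).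
  by move=> jS; apply: hX; rewrite inE jS orbT.
have [sgi [mXi Xi]] : 0 < sg i /\ is_centered_normal P (sg i) (X i).
  by apply: hX; rewrite inE eqxx.
pose s w := \sum_(j <- S) al j * X j w.
pose t w := \sum_(j <- S) be j * X j w.
have mXS j : j \in S -> measurable_fun setT (X j) by move=> /hX' [_ []].
have mZ : measurable_fun setT (fun w => (s w, t w)).
  by apply: measurable_fun_pair; apply: measurable_sum_in => j jS;
    apply: measurable_funM => //; exact: mXS.
pose Z : {mfun Omega >-> (R * R)%type} :=
  HB.pack (fun w => (s w, t w)) (isMeasurableFun.Build _ _ _ _ _ mZ).
have mXi' : measurable_fun setT (X i : Omega -> measurableTypeR R) by exact: mXi.
pose X' : {mfun Omega >-> measurableTypeR R} :=
  HB.pack (X i : Omega -> measurableTypeR R) (isMeasurableFun.Build _ _ _ _ _ mXi').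
pose F (z : (R * R) * measurableTypeR R) : \bar R :=
  (expR (- (l * (z.1.1 + al i * z.2) ^+ 2)) *
   expR (- (m * (z.1.2 + be i * z.2) ^+ 2)))%:E.
have mF : measurable_fun setT F.
  apply/measurable_EFinP; apply: measurable_funM; apply: measurableT_comp => //;
  apply: measurableT_comp => //; apply: measurable_funM => //;
  apply: measurable_funX; apply: measurable_funD.
  - exact: measurableT_comp measurable_fst measurable_fst.
  - by apply: measurable_funM => //; exact: measurable_snd.
  - exact: measurableT_comp measurable_snd measurable_fst.
  - by apply: measurable_funM => //; exact: measurable_snd.
transitivity (\int[P]_w F (Z w, X' w))%E.
  apply: eq_integral => w _; rewrite /F /= !big_cons.
  by rewrite ![_ * X i w + _]addrC.
rewrite (@indep_fubini _ _ _ _ _ _ _ _ (normal_prob 0 (sg i))) //; last 2 first.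
- move=> A B mA mB.
  transitivity (P (Z @^-1` A) * P (X i @^-1` B))%E; last first.
    by congr (_ * _)%E; exact: Xi.
  apply: (indep_event ind uS sJ _ mB) => [j|].
    by rewrite inE => /orP[/eqP ->//|]; exact: mXS.
  (* The remaining pair of sums is measurable for the sigma-algebra generated by the events over
     [S]. *)
  set G := [set E | _].
  have mXG j : j \in S -> measurable_fun setT (X j : g_sigma_algebraType G -> R).
    move=> jS _ C mC; rewrite setTI; apply: sub_sigma_algebra.
    exists (fun j' => if j' == j then C else setT); first by move=> j'; case: ifP.
    apply/seteqP; split => w /=; first by move=> Cw j' /= _; case: eqP => [->|].
    by move=> /(_ j jS); rewrite eqxx.
  have mZG : measurable_fun setT (fun w : g_sigma_algebraType G => (s w, t w)).
    by apply: measurable_fun_pair; apply: measurable_sum_in => j jS;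
      apply: measurable_funM => //; exact: mXG.
  by have := mZG measurableT _ mA; rewrite setTI.
- by move=> z; rewrite lee_fin mulr_ge0 ?expR_ge0.
have sq0 (x : R) : 0 <= x ^+ 2 := sqr_ge0 x.
have d1 (l' x : R) : 0 <= l' -> 0 < 1 + 2 * l' * x ^+ 2.
  by move=> l'0; rewrite ltr_pwDl // mulr_ge0 // mulr_ge0.
under eq_integral => w _.
  rewrite /F /= integral_normal_expR_sqr2 // EFinM; over.
rewrite ge0_integralZl_EFin ?mulr_ge0 ?gfactor_ge0 //=; last first.
  apply/measurable_EFinP; apply: measurable_funM; apply: measurableT_comp => //;
  apply: measurableT_comp => //; apply: measurable_funM => //;
  apply: measurable_funX; apply: measurable_sum_in => j jS;
  apply: measurable_funM => //; exact: mXS.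
rewrite IH //; try by rewrite divr_ge0 // ltW // d1.
rewrite -EFinM !big_cons -!gfactorD //; congr (_%:E); ring.
Qed.

(* [Y] behaves like a centred Gaussian whose variance is the limit of [V]. *)
Definition gauss_limit (R : realType) (d : measure_display) (Omega : measurableType d)
  (P : probability Omega R) (Y : Omega -> R) (V : nat -> R) : Prop :=
  measurable_fun setT Y /\
  forall l : R, 0 <= l ->
    (gfactor l (V N))%:E @[N --> \oo] -->
      (\int[P]_w (expR (- (l * Y w ^+ 2)))%:E)%E.

(** * Deviation bounds and Borel-Cantelli *)

Lemma gfactor_anti (R : realType) (l V W : R) : 0 <= l -> 0 <= V -> V <= W ->
  gfactor l W <= gfactor l V.
Proof.
move=> l0 V0 VW; have h x : 0 <= x -> 0 < 1 + 2 * l * x.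
  by move=> x0; rewrite ltr_pwDl // mulr_ge0 // mulr_ge0.
rewrite /gfactor lef_pV2 ?posrE ?sqrtr_gt0 ?h // ?(le_trans V0) //.
by rewrite ler_wsqrtr // lerD2l ler_wpM2l // mulr_ge0.
Qed.

Lemma gfactor_lower (R : realType) (l V : R) : 0 <= l -> 0 <= V ->
  1 - l * V <= gfactor l V.
Proof.
move=> l0 V0; have lV := mulr_ge0 l0 V0.
have h : 0 < 1 + 2 * l * V by lra.
rewrite /gfactor -[leRHS]mul1r ler_pdivlMr ?sqrtr_gt0 //.
have s1 : Num.sqrt (1 + 2 * l * V) <= 1 + l * V.
  rewrite -[leRHS](ger0_norm) ?addr_ge0 // -sqrtr_sqr ler_wsqrtr //.
  by have := sqr_ge0 (l * V); rewrite !expr2; lra.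
have s0 := sqrtr_ge0 (1 + 2 * l * V).
have [h1|h1] := leP (l * V) 1; last first.
  by apply: (@le_trans _ _ 0) => //; rewrite mulr_le0_ge0 //; lra.
apply: (@le_trans _ _ ((1 - l * V) * (1 + l * V))).
  by rewrite ler_wpM2l //; lra.
have := sqr_ge0 (l * V); rewrite !expr2; lra.
Qed.

Lemma expR1_ge2 (R : realType) : 2 <= expR 1 :> R.
Proof. by have := expR_ge1Dx (1 : R); lra. Qed.

Lemma measurable_expR_Nsqr (R : realType) (d : measure_display) (T : measurableType d)
  (l : R) (Y : T -> R) : measurable_fun setT Y ->
  measurable_fun setT (fun w => expR (- (l * Y w ^+ 2))).
Proof.
move=> mY; apply: measurableT_comp => //; apply: measurableT_comp => //.
by apply: measurable_funM => //; apply: measurable_funX.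
Qed.

(** At [l = r^-2] the integrand is at most [e^-1 <= 1/2] on the event, so its mean is at most
    [1 - P(A) / 2], and it is at least [1 - l K]. The rate is Chebyshev's, obtained without a second
    moment of the limit [Y]. *)
Lemma gauss_limit_tail (R : realType) (d : measure_display) (Omega : measurableType d)
  (P : probability Omega R) (Y : Omega -> R) (V : nat -> R) (K r : R) :
  gauss_limit P Y V -> (forall N, 0 <= V N <= K) -> 0 < r ->
  (P [set w | (r <= `|Y w|)%R] <= (2 * K / r ^+ 2)%:E)%E.
Proof.
move=> [mY lY] VK r0; set A := [set w | _].
have mA : measurable A.
  rewrite -[A]setTI; apply: (measurable_fun_le (f := cst r) (g := fun w => `|Y w|)) => //.
  exact: measurableT_comp.
pose l := (r ^+ 2)^-1; have l0 : 0 <= l by rewrite invr_ge0 sqr_ge0.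
have K0 : 0 <= K by have /andP[h1 h2] := VK 0%N; exact: le_trans h2.
have hI : ((1 - l * K)%:E <= \int[P]_w (expR (- (l * Y w ^+ 2)))%:E)%E.
  apply: (cvge_to_ge (lY l l0)); apply: nearW => N; rewrite lee_fin.
  have /andP[h1 h2] := VK N.
  by apply: le_trans (gfactor_anti l0 h1 h2); exact: gfactor_lower.
have hU : (\int[P]_w (expR (- (l * Y w ^+ 2)))%:E + 2^-1%:E * P A <= 1)%E.
  have -> : (2^-1%:E * P A = \int[P]_w (2^-1 * \1_A w)%:E)%E.
    under eq_integral do rewrite EFinM.
    rewrite ge0_integralZl_EFin // ?integral_indic ?setIT //.
    exact/measurable_EFinP.
  rewrite -ge0_integralD //; last 2 first.
  - exact/measurable_EFinP/measurable_expR_Nsqr.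
  - by apply/measurable_EFinP; apply: measurable_funM.
  rewrite -(probability_setT P) -[leRHS]mul1e -integral_cst //.
  apply: ge0_le_integral => //.
  - by move=> w _; rewrite -EFinD lee_fin addr_ge0 ?expR_ge0.
  - apply: emeasurable_funD; apply/measurable_EFinP; first exact: measurable_expR_Nsqr.
    by apply: measurable_funM.
  move=> w _; rewrite -EFinD lee_fin indicE.
  have [|wA] := boolP (w \in A); last by rewrite mulr0 addr0 expR_sqr_le1.
  rewrite inE /A /= mulr1 => rY.
  have h : expR (- (l * Y w ^+ 2)) <= expR (- 1).
    rewrite ler_expR lerN2 /l mulrC ler_pdivlMr ?exprn_gt0 // mul1r.
    by rewrite -(real_normK (num_real (Y w))) lerXn2r ?nnegrE // ltW.
  have : expR (-1) <= 2^-1 :> R.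
    by rewrite expRN lef_pV2 ?posrE ?expR_gt0 ?expR1_ge2.
  lra.
have fA : P A \is a fin_num by rewrite fin_num_measure.
move: hU; rewrite -(fineK fA) -EFinM => hU.
have : ((1 - l * K)%:E + (2^-1 * fine (P A))%:E <= 1%:E)%E.
  by apply: le_trans hU; rewrite leeD2r.
by rewrite -EFinD !lee_fin /l mulrC; lra.
Qed.

(** Markov's inequality at [l = r^-2]: the integrand is at least [e^-1] on the event and its mean is
    at most [(l K)^(-1/2)]. The bound on [V N] is asked from [N0] on, because a truncation must
    reach frequencies of order [1 / h] before it shows the variance. *)
Lemma gauss_limit_small (R : realType) (d : measure_display) (Omega : measurableType d)
  (P : probability Omega R) (Y : Omega -> R) (V : nat -> R) (K r : R) (N0 : nat) :
  gauss_limit P Y V -> (forall N, (N0 <= N)%N -> K <= V N) -> 0 < K -> 0 < r ->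
  (P [set w | (`|Y w| <= r)%R] <= (expR 1 * (r / Num.sqrt K))%:E)%E.
Proof.
move=> [mY lY] VK K0 r0; set A := [set w | _].
have mA : measurable A.
  rewrite -[A]setTI; apply: (measurable_fun_le (f := fun w => `|Y w|) (g := cst r)) => //.
  exact: measurableT_comp.
pose l := (r ^+ 2)^-1; have l0 : 0 < l by rewrite invr_gt0 exprn_gt0.
have hI : (\int[P]_w (expR (- (l * Y w ^+ 2)))%:E <= (r / Num.sqrt K)%:E)%E.
  apply: (cvge_to_le (lY l (ltW l0))); exists N0 => // N /= N0N; rewrite lee_fin.
  apply: (le_trans (gfactor_anti (ltW l0) (ltW K0) (VK N N0N))).
  have lK := mulr_gt0 l0 K0.
  have -> : r / Num.sqrt K = (Num.sqrt (l * K))^-1.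
    rewrite sqrtrM ?(ltW l0) // /l sqrtrV ?sqr_ge0 // sqrtr_sqr gtr0_norm //.
    by rewrite invfM invrK.
  have lK2 : 0 < 1 + 2 * l * K by lra.
  by rewrite /gfactor lef_pV2 ?posrE ?sqrtr_gt0 // ler_wsqrtr //; lra.
have hU : ((expR (-1))%:E * P A <= \int[P]_w (expR (- (l * Y w ^+ 2)))%:E)%E.
  have -> : ((expR (-1))%:E * P A = \int[P]_w (expR (-1) * \1_A w)%:E)%E.
    under eq_integral do rewrite EFinM.
    rewrite ge0_integralZl_EFin ?expR_ge0 // ?integral_indic ?setIT //.
    exact/measurable_EFinP.
  apply: ge0_le_integral => //.
  - by apply/measurable_EFinP; apply: measurable_funM.
  - exact/measurable_EFinP/measurable_expR_Nsqr.
  move=> w _; rewrite lee_fin indicE.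
  have [|wA] := boolP (w \in A); last by rewrite mulr0 expR_ge0.
  rewrite inE /A /= mulr1 => rY.
  rewrite ler_expR lerN2 /l mulrC ler_pdivrMr ?exprn_gt0 // mul1r.
  by rewrite -(real_normK (num_real (Y w))) lerXn2r ?nnegrE // ltW.
have fA : P A \is a fin_num by rewrite fin_num_measure.
have := le_trans hU hI; rewrite -(fineK fA) -EFinM !lee_fin expRN => h.
by rewrite mulrC -ler_pdivrMr ?expR_gt0 // mulrC.
Qed.

Lemma borel_cantelli_geometric (R : realType) (d : measure_display)
  (Omega : measurableType d) (P : probability Omega R) (A : nat -> set Omega) (C x : R) :
  (forall j, measurable (A j)) -> 0 <= x < 1 -> 0 <= C ->
  (forall j, P (A j) <= (C * x ^+ j)%:E)%E ->
  P (lim_sup_set A) = 0%E.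
Proof.
move=> mA x01 C0 hA; apply: lim_sup_set_cvg0 => //.
apply: (@le_lt_trans _ _ (C * (1 - x)^-1)%:E); last exact: ltry.
apply: lime_le; first by apply: is_cvg_nneseries => j _ _; exact: measure_ge0.
apply: nearW => n.
apply: (@le_trans _ _ (\sum_(0 <= j < n) (C * x ^+ j)%:E)%E).
  by apply: lee_sum => j _; exact: hA.
rewrite sumEFin lee_fin -mulr_sumr ler_wpM2l // big_mkord.
exact: geometric_sum_bound.
Qed.

Lemma ae_eventually (R : realType) (d : measure_display) (Omega : measurableType d)
  (P : probability Omega R) (A : nat -> set Omega) (C x : R) :
  (forall j, measurable (A j)) -> 0 <= x < 1 -> 0 <= C ->
  (forall j, P (A j) <= (C * x ^+ j)%:E)%E ->
  {ae P, forall w, exists j0, forall j, (j0 <= j)%N -> ~ A j w}.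
Proof.
move=> mA x01 C0 hA; exists (lim_sup_set A); split => //.
- by apply: bigcap_measurableType => k _; apply: bigcup_measurable.
- exact: borel_cantelli_geometric hA.
move=> w /= h n _ /=; apply: contrapT => h'; apply: h; exists n => j nj Aj.
by apply: h'; exists j.
Qed.

(** * The random fields *)

Record gaussian_modes (R : realType) (d : measure_display) (Omega : measurableType d)
  (P : probability Omega R) (a b c e : Z3 -> Omega -> R) : Prop := GaussianModes {
  modes_indep : mutually_independent P indep_index (gauss_family a b c e);
  modes_pos : forall n, Z3pos n ->
     [/\ is_centered_normal P (Num.sqrt (2^-1)) (a n),
         is_centered_normal P (Num.sqrt (2^-1)) (b n),
         is_centered_normal P (Num.sqrt (2^-1)) (c n)
       & is_centered_normal P (Num.sqrt (2^-1)) (e n)];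
  modes_a0 : is_centered_normal P 1 (a (0, 0, 0));
  modes_c0 : is_centered_normal P 1 (c (0, 0, 0));
  modes_conj : forall n, [/\ a (Z3neg n) = a n, b (Z3neg n) = (fun w => - b n w),
                 c (Z3neg n) = c n & e (Z3neg n) = (fun w => - e n w)] }.

Lemma modes_normal (R : realType) (d : measure_display) (Omega : measurableType d)
  (P : probability Omega R) (a b c e : Z3 -> Omega -> R) N i :
  gaussian_modes P a b c e -> i \in gauss_idx N ->
  0 < gauss_sd R i /\ is_centered_normal P (gauss_sd R i) (gauss_family a b c e i).
Proof.
move=> gm; have s0 : 0 < Num.sqrt 2^-1 :> R by rewrite sqrtr_gt0 invr_gt0.
case: i => n j; rewrite mem_cat mem_allpairs_pair mem_filter mem_iota !inE !xpair_eqE.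
rewrite /gauss_sd /gauss_family /=.
case/orP => [/orP[]/andP[/eqP-> /eqP->]|].
- by split => //; exact: modes_a0 gm.
- by split => //; exact: modes_c0 gm.
move=> /andP[/andP[n0 _] j4].
have -> : (n == (0, 0, 0)) = false by apply/eqP => h; rewrite h Z3pos0 in n0.
have [ha hb hc he] := modes_pos gm n0.
by split => //; case: j j4 => [|[|[|[|j]]]].
Qed.

Definition mode_sum (R : realType) (Omega : Type) (A B : Z3 -> Omega -> R) (r h : R)
  (l i N : nat) (w : Omega) : R :=
  'D^l (fun i => cube_sum N (fun n => fourier_term (A n w) (B n w) r n (gpt h i))) i.

Definition spectral (R : realType) (r h : R) (l N : nat) : R :=
  cube_sum N (fun n => ((jbr R n `^ r)^-1) ^+ 2 * (2 - 2 * cos (n.1.1%:~R * h)) ^+ l).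

Lemma spectral_ge0 (R : realType) (r h : R) (l N : nat) : 0 <= spectral r h l N.
Proof. by rewrite /spectral cube_sumE sumr_ge0 // => n _; exact: spectral_term_ge0. Qed.

Lemma mode_sumE (R : realType) (Omega : Type) (A B : Z3 -> Omega -> R) (r h : R)
  (l i N : nat) (w : Omega) :
  mode_sum A B r h l i N w =
  cube_sum N (fun n => (A n w * dcos h l i n - B n w * dsin h l i n) * (jbr R n `^ r)^-1).
Proof.
rewrite /mode_sum fdiff_cube_sum !cube_sumE; apply: eq_bigr => n _.
rewrite /fourier_term /dcos /dsin mulrC -!fdiffZ -fdiffN -fdiffD -fdiffZ.
by congr ('D^_ _ _); apply/funext => p; rewrite mulrC.
Qed.

(** [u] uses the components 0 and 1, [v] the components 2 and 3: the coefficient families have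
    disjoint supports, so the expectation factorises. *)
Lemma modes_expectation (R : realType) (d : measure_display) (Omega : measurableType d)
  (P : probability Omega R) (a b c e : Z3 -> Omega -> R) (r1 h1 r2 h2 : R)
  (l1 i1 l2 i2 N : nat) (l m : R) :
  gaussian_modes P a b c e -> 0 <= l -> 0 <= m ->
  (\int[P]_w (expR (- (l * mode_sum a b r1 h1 l1 i1 N w ^+ 2)) *
              expR (- (m * mode_sum c e r2 h2 l2 i2 N w ^+ 2)))%:E =
   (gfactor l (spectral r1 h1 l1 N) * gfactor m (spectral r2 h2 l2 N))%:E)%E.
Proof.
move=> gm l0 m0.
pose W (r : R) n := (jbr R n `^ r)^-1.
have We r n : W r (Z3neg n) = W r n by rewrite /W jbr_neg.
have sa n w : a (Z3neg n) w = a n w by have [-> _ _ _] := modes_conj gm n.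
have sb n w : b (Z3neg n) w = - b n w by have [_ -> _ _] := modes_conj gm n.
have sc n w : c (Z3neg n) w = c n w by have [_ _ -> _] := modes_conj gm n.
have se n w : e (Z3neg n) w = - e n w by have [_ _ _ ->] := modes_conj gm n.
pose al := gauss_coef 0 (dcos h1 l1 i1) (dsin h1 l1 i1) (W r1).
pose be := gauss_coef 2 (dcos h2 l2 i2) (dsin h2 l2 i2) (W r2).
have E1 w : mode_sum a b r1 h1 l1 i1 N w =
    \sum_(i <- gauss_idx N) al i * gauss_family a b c e i w.
  rewrite mode_sumE.
  apply: (@gauss_coef_sum R Omega a b c e _ _ _ N false w) => //.
  - exact: dcos_neg.
  - exact: dsin_neg.
  - exact: We.
  - exact: dsin0.
have E2 w : mode_sum c e r2 h2 l2 i2 N w =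
    \sum_(i <- gauss_idx N) be i * gauss_family a b c e i w.
  rewrite mode_sumE.
  apply: (@gauss_coef_sum R Omega a b c e _ _ _ N true w) => //.
  - exact: dcos_neg.
  - exact: dsin_neg.
  - exact: We.
  - exact: dsin0.
under eq_integral do rewrite E1 E2.
rewrite (@expectation_expR_sqr _ _ _ _ _ _ _ (gauss_sd R) al be (gauss_idx N)
  (modes_indep gm)) ?gauss_idx_uniq //; last 3 first.
- exact: gauss_idx_sub.
- by move=> j; exact: modes_normal.
- move=> [n j]; rewrite /al /be /gauss_coef /=.
  by case: j => [|[|[|[|j]]]] /=; rewrite ?(mulr0, mul0r).
have hv r h l' i (v : bool) : \sum_(j <- gauss_idx N)
   (gauss_coef (if v then 2 else 0) (dcos h l' i) (dsin h l' i) (W r) j * gauss_sd R j) ^+ 2 =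
   spectral r h l' N.
  rewrite gauss_coef_var ?dsin0 //.
  - by apply: congr1; apply/funext => n; rewrite dcos_dsin_sqr.
  - exact: dcos_neg.
  - exact: dsin_neg.
by rewrite (hv r1 h1 l1 i1 false) (hv r2 h2 l2 i2 true).
Qed.

Lemma fdiff_cvg (R : realType) (F : nat -> nat -> R) (f : nat -> R) :
  (forall i, F^~ i @ \oo --> f i) ->
  forall l i, (fun N => 'D^l (F N) i) @ \oo --> 'D^l f i.
Proof.
move=> Ff; elim=> [|l IH] i; first exact: Ff.
by rewrite fdiffS; under eq_fun do rewrite fdiffS; apply: cvgB.
Qed.

Lemma measurable_fdiff (R : realType) (d : measure_display) (T : measurableType d)
  (F : nat -> T -> R) : (forall i, measurable_fun setT (F i)) ->
  forall l i, measurable_fun setT (fun w => 'D^l (F^~ w) i).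
Proof.
move=> mF; elim=> [|l IH] i; first exact: mF.
by under eq_fun do rewrite fdiffS; apply: measurable_funB.
Qed.

Lemma measurable_cube_sum (R : realType) (d : measure_display) (T : measurableType d)
  (F : Z3 -> T -> R) N : (forall n, measurable_fun setT (F n)) ->
  measurable_fun setT (fun w => cube_sum N (F^~ w)).
Proof.
by move=> mF; under eq_fun do rewrite cube_sumE; apply: measurable_sum.
Qed.

Lemma measurable_modes (R : realType) (d : measure_display) (Omega : measurableType d)
  (P : probability Omega R) (a b c e : Z3 -> Omega -> R) :
  gaussian_modes P a b c e -> b (0, 0, 0) = (fun=> 0) -> e (0, 0, 0) = (fun=> 0) ->
  forall n, [/\ measurable_fun setT (a n), measurable_fun setT (b n),
                measurable_fun setT (c n) & measurable_fun setT (e n)].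
Proof.
move=> gm b0 e0 n.
have hp n' : Z3pos n' -> [/\ measurable_fun setT (a n'), measurable_fun setT (b n'),
                measurable_fun setT (c n') & measurable_fun setT (e n')].
  by move=> n0; have [[? _] [? _] [? _] [? _]] := modes_pos gm n0.
have [n0|] := boolP (Z3pos n); first exact: hp.
have [->|n00] := eqVneq n (0, 0, 0).
  move=> _; rewrite b0 e0; split => //.
  - by have [] := modes_a0 gm.
  - by have [] := modes_c0 gm.
rewrite Z3pos_neg // => /hp [ma mb mc me].
rewrite -(Z3negK n); have [-> -> -> ->] := modes_conj gm (Z3neg n).
by split => //; exact: measurableT_comp.
Qed.

(** Dominated convergence with the constant 1. The joint form serves the small-data event; a single
    field is recovered by giving the other the multiplier 0. *)
Lemma field_expectation (R : realType) (d : measure_display) (Omega : measurableType d)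
  (P : probability Omega R) (a b c e : Z3 -> Omega -> R) (u v : Omega -> pt3 R -> R)
  (r1 h1 r2 h2 : R) (l1 i1 l2 i2 : nat) (l m : R) :
  gaussian_modes P a b c e -> b (0, 0, 0) = (fun=> 0) -> e (0, 0, 0) = (fun=> 0) ->
  (forall x, measurable_fun setT (fun w => u w x)) ->
  (forall x, measurable_fun setT (fun w => v w x)) ->
  {ae P, forall w, forall x,
     (fun N => cube_sum N (fun n => fourier_term (a n w) (b n w) r1 n x))
       @ \oo --> u w x} ->
  {ae P, forall w, forall x,
     (fun N => cube_sum N (fun n => fourier_term (c n w) (e n w) r2 n x))
       @ \oo --> v w x} ->
  0 <= l -> 0 <= m ->
  (gfactor l (spectral r1 h1 l1 N) * gfactor m (spectral r2 h2 l2 N))%:E @[N --> \oo] -->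
  (\int[P]_w (expR (- (l * 'D^l1 (fun i => u w (gpt h1 i)) i1 ^+ 2)) *
              expR (- (m * 'D^l2 (fun i => v w (gpt h2 i)) i2 ^+ 2)))%:E)%E.
Proof.
move=> gm b0 e0 mu mv cu cv l0 m0.
have mm := measurable_modes gm b0 e0.
have mft (A B : Z3 -> Omega -> R) r h l' i' N :
    (forall n, measurable_fun setT (A n)) -> (forall n, measurable_fun setT (B n)) ->
    measurable_fun setT (mode_sum A B r h l' i' N).
  move=> mA mB; apply: measurable_fdiff => i; apply: measurable_cube_sum => n.
  by apply: measurable_funM => //; apply: measurable_funB; apply: measurable_funM.
pose G (x y : R) := expR (- (l * x ^+ 2)) * expR (- (m * y ^+ 2)).
have mG X Y : measurable_fun setT X -> measurable_fun setT Y ->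
    measurable_fun setT (fun w : Omega => (G (X w) (Y w))%:E).
  by move=> mX mY; apply/measurable_EFinP; apply: measurable_funM;
    exact: measurable_expR_Nsqr.
have ce (p : R) : continuous (fun x : R => expR (- (p * x ^+ 2))).
  move=> x; apply: continuous_comp; last exact: continuous_expR.
  apply: continuousN; apply: continuousM; first exact: cst_continuous.
  exact: exprn_continuous.
pose fN N w := (G (mode_sum a b r1 h1 l1 i1 N w) (mode_sum c e r2 h2 l2 i2 N w))%:E.
pose f w := (G ('D^l1 (fun i => u w (gpt h1 i)) i1) ('D^l2 (fun i => v w (gpt h2 i)) i2))%:E.
have mfN N : measurable_fun setT (fN N).
  by apply: mG; apply: mft => n; have [] := mm n.
have mf : measurable_fun setT f.
  by apply: mG; apply: measurable_fdiff => i.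
have cf : {ae P, forall w, setT w -> fN^~ w @ \oo --> f w}.
  apply: filterS2 cu cv => w cu cv _.
  apply: cvg_EFin; first by apply: nearW.
  apply: cvgM.
    apply: (cvg_comp _ (fun x => expR (- (l * x ^+ 2)))); last exact: ce.
    exact: fdiff_cvg.
  apply: (cvg_comp _ (fun x => expR (- (m * x ^+ 2)))); last exact: ce.
  exact: fdiff_cvg.
have i1' : P.-integrable setT (cst 1%E) by exact: finite_measure_integrable_cst.
have bf : {ae P, forall w N, setT w -> (`|fN N w| <= cst 1 w)%E}.
  apply: aeW => w N _; rewrite /= lee_fin ger0_norm ?mulr_ge0 ?expR_ge0 //.
  by rewrite -[leRHS]mulr1 ler_pM ?expR_ge0 ?expR_sqr_le1.
have [_ _] := dominated_convergence measurableT mfN mf cf i1' bf.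
apply: cvg_trans; apply: near_eq_cvg; apply: nearW => N.
by rewrite /= /fN /G modes_expectation.
Qed.

Definition random_fields (R : realType) (d : measure_display) (Omega : measurableType d)
  (P : probability Omega R) (s : R) (a b c e : Z3 -> Omega -> R)
  (u v : Omega -> pt3 R -> R) : Prop :=
  [/\ gaussian_modes P a b c e,
      b (0, 0, 0) = (fun=> 0) /\ e (0, 0, 0) = (fun=> 0),
      (forall x, measurable_fun setT (fun w => u w x)) /\
      (forall x, measurable_fun setT (fun w => v w x)),
      {ae P, forall w, forall x,
        (fun N => cube_sum N (fun n => fourier_term (a n w) (b n w) (s + 1) n x))
          @ \oo --> u w x} &
      {ae P, forall w, forall x,
        (fun N => cube_sum N (fun n => fourier_term (c n w) (e n w) s n x))
          @ \oo --> v w x}].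

Lemma gauss_limit_u (R : realType) (d : measure_display) (Omega : measurableType d)
  (P : probability Omega R) (s : R) (a b c e : Z3 -> Omega -> R)
  (u v : Omega -> pt3 R -> R) (h : R) l i : random_fields P s a b c e u v ->
  gauss_limit P (fun w => 'D^l (fun i => u w (gpt h i)) i) (spectral (s + 1) h l).
Proof.
move=> [gm [b0 e0] [mu mv] cu cv]; split; first by apply: measurable_fdiff => j; exact: mu.
move=> p p0.
have := field_expectation (h1 := h) (h2 := 0) (l1 := l) (i1 := i) (l2 := 0) (i2 := 0)
  gm b0 e0 mu mv cu cv p0 (lexx 0).
under eq_integral do rewrite mul0r oppr0 expR0 mulr1.
apply: cvg_trans; apply: near_eq_cvg; apply: nearW => N.
by rewrite {2}/gfactor mulr0 mul0r addr0 sqrtr1 invr1 mulr1.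
Qed.

Lemma gauss_limit_v (R : realType) (d : measure_display) (Omega : measurableType d)
  (P : probability Omega R) (s : R) (a b c e : Z3 -> Omega -> R)
  (u v : Omega -> pt3 R -> R) (h : R) l i : random_fields P s a b c e u v ->
  gauss_limit P (fun w => 'D^l (fun i => v w (gpt h i)) i) (spectral s h l).
Proof.
move=> [gm [b0 e0] [mu mv] cu cv]; split; first by apply: measurable_fdiff => j; exact: mv.
move=> p p0.
have := field_expectation (h1 := 0) (h2 := h) (l1 := 0) (i1 := 0) (l2 := l) (i2 := i)
  gm b0 e0 mu mv cu cv (lexx 0) p0.
under eq_integral do rewrite mul0r oppr0 expR0 mul1r.
apply: cvg_trans; apply: near_eq_cvg; apply: nearW => N.
by rewrite {1}/gfactor mulr0 mul0r addr0 sqrtr1 invr1 mul1r.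
Qed.

Lemma measurable_lt_set (R : realType) (d : measure_display) (T : measurableType d)
  (f g : T -> R) : measurable_fun setT f -> measurable_fun setT g ->
  measurable [set w | (f w < g w)%R].
Proof.
move=> mf mg; have := measurable_fun_ltr mf mg measurableT (Y := [set true]).
by rewrite setTI; apply.
Qed.

(** If the event were null, one of [|u|], [|v|] would almost surely be at least [de], and
    [E exp(-l (u^2 + v^2))] would be at most [exp(-l de^2)]. The Gaussian formula keeps it above
    [1 / (1 + 2 l K)], which is absurd for large [l]. *)
Lemma small_data_pos (R : realType) (d : measure_display) (Omega : measurableType d)
  (P : probability Omega R) (s : R) (a b c e : Z3 -> Omega -> R)
  (u v : Omega -> pt3 R -> R) (de : R) : random_fields P s a b c e u v ->
  3 / 2 < s -> 0 < de ->
  P [set w | (`|u w (0, 0, 0)| < de)%R /\ (`|v w (0, 0, 0)| < de)%R] <> 0%E.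
Proof.
move=> [gm [b0 e0] [mu mv] cu cv] s32 de0; set A := [set w | _] => PA0.
have g0 : gpt (1 : R) 0 = (0, 0, 0) by rewrite /gpt mul0r.
have mA : measurable A.
  have -> : A = [set w | (`|u w (0, 0, 0)| < de)%R] `&` [set w | (`|v w (0, 0, 0)| < de)%R].
    by [].
  by apply: measurableI; apply: measurable_lt_set => //; apply: measurableT_comp.
have zz : 0 <= (0 : R) <= 0%:R by rewrite lexx.
have [K1 K10 HK1] : exists2 K : R, 0 <= K & forall N, spectral (s + 1) 1 0 N <= K.
  have [||K K0 HK] := @spectral_upper R (s + 1) 0 0 => //; first by lra.
  exists K => // N; apply: (le_trans (HK 1 N ltr01)).
  by rewrite mulr0 powRr0 mulr1.
have [K2 K20 HK2] : exists2 K : R, 0 <= K & forall N, spectral s 1 0 N <= K.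
  have [||K K0 HK] := @spectral_upper R s 0 0 => //; first by lra.
  exists K => // N; apply: (le_trans (HK 1 N ltr01)).
  by rewrite mulr0 powRr0 mulr1.
pose K := K1 + K2.
have hl l : 0 <= l -> 1 / (1 + 2 * l * K) <= expR (- (l * de ^+ 2)).
  move=> l0.
  have := field_expectation (h1 := 1) (h2 := 1) (l1 := 0) (i1 := 0) (l2 := 0) (i2 := 0)
    gm b0 e0 mu mv cu cv l0 l0.
  under eq_integral do rewrite /= g0.
  set I := (\int[P]_w _)%E => cI.
  have h1 : ((1 / (1 + 2 * l * K))%:E <= I)%E.
    apply: (cvge_to_ge cI); apply: nearW => N; rewrite lee_fin.
    have lK : 0 <= 2 * l * K by rewrite !mulr_ge0 // addr_ge0.
    have gK : (Num.sqrt (1 + 2 * l * K))^-1 = gfactor l K by [].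
    rewrite mul1r -{1}(sqr_sqrtr (_ : 0 <= 1 + 2 * l * K)) ?addr_ge0 // -exprVn gK expr2.
    apply: ler_pM; rewrite ?gfactor_ge0 //; apply: gfactor_anti; rewrite ?spectral_ge0 //.
      by rewrite (le_trans (HK1 N)) // lerDl.
    by rewrite (le_trans (HK2 N)) // lerDr.
  have h2 : (I <= (expR (- (l * de ^+ 2)))%:E)%E.
    have -> : (expR (- (l * de ^+ 2)))%:E =
        (\int[P]_w ((\1_A w)%:E + (expR (- (l * de ^+ 2)))%:E))%E.
      rewrite ge0_integralD //; last exact/measurable_EFinP.
      have -> : (\int[P]_w (\1_A w)%:E = 0)%E by rewrite integral_indic // setIT.
      by rewrite add0e integral_cst //= probability_setT mule1.
    apply: ge0_le_integral => //.
    - by apply/measurable_EFinP; apply: measurable_funM; apply: measurable_expR_Nsqr.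
    - by apply: emeasurable_funD => //; exact/measurable_EFinP.
    move=> w _; rewrite -EFinD lee_fin indicE.
    have [wA|] := boolP (w \in A).
      apply: (@le_trans _ _ 1); last by rewrite lerDl expR_ge0.
      by rewrite -[leRHS]mulr1 ler_pM ?expR_ge0 ?expR_sqr_le1.
    rewrite notin_setE /A /= => nA; rewrite add0r.
    have sq (x : R) : ~ (`|x| < de) -> expR (- (l * x ^+ 2)) <= expR (- (l * de ^+ 2)).
      move=> /negP; rewrite -leNgt => dx; rewrite ler_expR lerN2 ler_wpM2l //.
      by rewrite -(real_normK (num_real x)) lerXn2r ?nnegrE // ltW.
    move/not_andP : nA => [/sq h|/sq h].
      by rewrite -[leRHS]mulr1 ler_pM ?expR_ge0 ?expR_sqr_le1.
    by rewrite -[leRHS]mul1r ler_pM ?expR_ge0 ?expR_sqr_le1.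
  by have := le_trans h1 h2; rewrite lee_fin.
have K0 : 0 <= K by rewrite addr_ge0.
(* Chosen so that [x = l de^2 / 2] satisfies [x^2 = l (2 K + 1)]; then
   [exp(2x) >= (1 + x)^2 > 1 + 2 l K]. *)
pose l := (8 * K + 4) / (de ^+ 2) ^+ 2.
have d20 : 0 < de ^+ 2 by rewrite exprn_gt0.
have l0 : 0 < l by rewrite divr_gt0 ?exprn_gt0 //; lra.
have := hl l (ltW l0).
rewrite expRN div1r lef_pV2 ?posrE ?expR_gt0 //; last first.
  by have := mulr_ge0 (ltW l0) K0; lra.
apply/negP; rewrite -ltNge.
pose x := l * de ^+ 2 / 2.
have x0 : 0 < x by rewrite divr_gt0 // mulr_gt0.
have -> : l * de ^+ 2 = x + x by rewrite /x; field.
rewrite expRD.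
apply: (@lt_le_trans _ _ ((1 + x) * (1 + x))); last first.
  by rewrite ler_pM ?expR_ge1Dx //; lra.
have : x * x = l * (2 * K + 1).
  by rewrite /x /l; field; rewrite gt_eqF.
have := mulr_ge0 (ltW l0) K0; lra.
Qed.

(** * Dyadic meshes and almost sure rates *)

Definition step (R : realType) (j : nat) : R := (2 ^+ j)^-1.

Lemma step_gt0 (R : realType) j : 0 < step R j.
Proof. by rewrite invr_gt0 exprn_gt0. Qed.

Lemma step_le1 (R : realType) j : step R j <= 1.
Proof. by rewrite invf_le1 ?exprn_gt0 // exprn_ege1 // ler1n. Qed.

Lemma step_powR (R : realType) (b : R) j : step R j `^ b = (2 `^ (- b)) ^+ j.
Proof.
rewrite -[step R j]powR_inv1 ?exprn_ge0 // -powR_mulrn // -powRrM -powRrM.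
by rewrite -powR_mulrn ?powR_ge0 // -powRrM; congr (_ `^ _); ring.
Qed.

Lemma step_powRD (R : realType) (b b' : R) j :
  step R j `^ (b + b') = step R j `^ b * step R j `^ b'.
Proof. by rewrite powRD //; apply/implyP => _; rewrite gt_eqF ?step_gt0. Qed.

Lemma step_powR_gt0 (R : realType) (b : R) j : 0 < step R j `^ b.
Proof. by rewrite powR_gt0 ?step_gt0. Qed.

Lemma step_powR_anti (R : realType) (b b' : R) j : b <= b' ->
  step R j `^ b' <= step R j `^ b.
Proof. by move=> bb; apply: ger_powR => //; rewrite step_gt0 step_le1. Qed.

Lemma powR2N_lt1 (R : realType) (b : R) : 0 < b -> 0 <= (2 : R) `^ (- b) < 1.
Proof.
move=> b0; rewrite powR_ge0 /= powR_expR_ln // -[ltRHS]expR0 ltr_expR.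
by rewrite mulNr oppr_lt0 mulr_gt0 // ln_gt0 // ltr1n.
Qed.

Lemma step_powR_small (R : realType) (b eps : R) : 0 < b -> 0 < eps ->
  exists j0, forall j, (j0 <= j)%N -> step R j `^ b <= eps.
Proof.
move=> b0 eps0; have /andP[x0 x1] := powR2N_lt1 b0.
have : (2 `^ (- b)) ^+ n @[n --> \oo] --> (0 : R) by apply: cvg_expr; rewrite ger0_norm.
move=> /cvgrPdist_le /(_ eps eps0) [j0 _ h]; exists j0 => j j0j.
have := h j j0j; rewrite /= sub0r normrN ger0_norm ?exprn_ge0 //.
by rewrite step_powR.
Qed.

Lemma eventually_forall_le (Q : nat -> nat -> Prop) M :
  (forall i, (i <= M)%N -> exists j0, forall j, (j0 <= j)%N -> Q i j) ->
  exists j0, forall j, (j0 <= j)%N -> forall i, (i <= M)%N -> Q i j.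
Proof.
elim: M => [|M IH] h.
  by have [j0 h0] := h 0%N isT; exists j0 => j /h0 ? [].
have [|j0 h0] := IH; first by move=> i iM; apply: h; exact: leqW.
have [j1 h1] := h M.+1 (leqnn _); exists (maxn j0 j1) => j.
rewrite geq_max => /andP[j0j j1j] i; rewrite leq_eqVlt => /orP[/eqP->|iM]; first exact: h1.
exact: h0.
Qed.

Lemma ae_forall_nat (R : realType) (d : measure_display) (Omega : measurableType d)
  (P : probability Omega R) (Q : nat -> Omega -> Prop) :
  (forall n, {ae P, forall w, Q n w}) -> {ae P, forall w, forall n, Q n w}.
Proof.
move=> h; have := negligible_bigcup h; apply: negligibleS => w /= /existsNP[n nQ].
by exists n.
Qed.

(** The surplus 1/8 in the exponent makes the tail probability [O(h^(1/4))], a geometric series over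
    dyadic meshes. *)
Lemma ae_tail (R : realType) (d : measure_display) (Omega : measurableType d)
  (P : probability Omega R) (Y : nat -> Omega -> R) (V : nat -> nat -> R) (K b : R) :
  (forall j, gauss_limit P (Y j) (V j)) -> 0 <= K ->
  (forall j N, 0 <= V j N <= K * step R j `^ (2 * (b + 8^-1))) ->
  {ae P, forall w, exists j0, forall j, (j0 <= j)%N -> `|Y j w| <= step R j `^ b}.
Proof.
move=> gY K0 hV.
have b4 : 0 < 4^-1 :> R by [].
have := @ae_eventually _ _ _ P (fun j => [set w | (step R j `^ b <= `|Y j w|)%R])
  (2 * K) (2 `^ (- 4^-1)) _ (powR2N_lt1 b4) _ _.
have H1 j : measurable [set w | (step R j `^ b <= `|Y j w|)%R].
  have -> : [set w | (step R j `^ b <= `|Y j w|)%R] =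
      ~` [set w | (`|Y j w| < step R j `^ b)%R].
    by apply/seteqP; split => w /=; rewrite leNgt => /negP.
  apply: measurableC; apply: measurable_lt_set => //; apply: measurableT_comp => //.
  by have [] := gY j.
move=> /(_ H1); rewrite mulr_ge0 // => /(_ isT) H; apply: filterS (H _).
  move=> w [j0 h]; exists j0 => j /h /= /negP; rewrite -ltNge; exact: ltW.
move=> j; apply: (le_trans (gauss_limit_tail (gY j) (hV j) (step_powR_gt0 _ _))).
rewrite lee_fin -step_powR -!mulrA ler_pM2l // ler_wpM2l //.
rewrite -powR_mulrn ?powR_ge0 // -powRrM ler_pdivrMr ?step_powR_gt0 //.
by rewrite -step_powRD; apply: step_powR_anti; lra.
Qed.

(** The standard deviation is at least of order [h^b], so falling below [h^(b + 1/4)] has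
    probability [O(h^(1/4))]. *)
Lemma ae_lower (R : realType) (d : measure_display) (Omega : measurableType d)
  (P : probability Omega R) (Y : nat -> Omega -> R) (V : nat -> nat -> R) (K b : R)
  (N0 : nat -> nat) :
  (forall j, gauss_limit P (Y j) (V j)) -> 0 < K ->
  (forall j N, (N0 j <= N)%N -> K * step R j `^ (2 * b) <= V j N) ->
  {ae P, forall w, exists j0, forall j, (j0 <= j)%N ->
     step R j `^ (b + 4^-1) <= `|Y j w|}.
Proof.
move=> gY K0 hV.
have b4 : 0 < 4^-1 :> R by [].
have K0' : 0 < K by [].
have := @ae_eventually _ _ _ P (fun j => [set w | (`|Y j w| <= step R j `^ (b + 4^-1))%R])
  (expR 1 / Num.sqrt K) (2 `^ (- 4^-1)) _ (powR2N_lt1 b4) _ _.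
have H1 j : measurable [set w | (`|Y j w| <= step R j `^ (b + 4^-1))%R].
  have -> : [set w | (`|Y j w| <= step R j `^ (b + 4^-1))%R] =
      ~` [set w | (step R j `^ (b + 4^-1) < `|Y j w|)%R].
    by apply/seteqP; split => w /=; rewrite leNgt => /negP.
  apply: measurableC; apply: measurable_lt_set => //; apply: measurableT_comp => //.
  by have [] := gY j.
move=> /(_ H1); rewrite divr_ge0 ?expR_ge0 ?sqrtr_ge0 // => /(_ isT) H.
apply: filterS (H _).
  move=> w [j0 h]; exists j0 => j /h /= /negP; rewrite -ltNge; exact: ltW.
move=> j.
have KV : 0 < K * step R j `^ (2 * b) by rewrite mulr_gt0 ?step_powR_gt0.
apply: (le_trans (gauss_limit_small (gY j) (hV j) KV (step_powR_gt0 _ _))).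
rewrite lee_fin -step_powR -!mulrA ler_pM2l ?expR_gt0 //.
have -> : Num.sqrt (K * step R j `^ (2 * b)) = Num.sqrt K * step R j `^ b.
  rewrite sqrtrM ?ltW // (_ : 2 * b = b + b); last by ring.
  by rewrite step_powRD -expr2 sqrtr_sqr gtr0_norm ?step_powR_gt0.
rewrite step_powRD.
have := step_powR_gt0 b j; move: (step R j `^ b) (step R j `^ 4^-1) => x y x0.
have : 0 < Num.sqrt K by rewrite sqrtr_gt0.
move: (Num.sqrt K) => z z0.
by rewrite (_ : x * y / (z * x) = z^-1 * y) //; field; rewrite !gt_eqF.
Qed.

(* Any [min (rho * l) (g - delta)] with [rho < 1] and small [delta] would do: the slack makes
   the almost sure bounds hold, and sums of two exponents of total order [m] still reach
   [g + 1/2] because [g > 1]. *)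
Definition beta (R : realType) (g : R) (l : nat) : R := Num.min (3 / 4 * l%:R) (g - 4^-1).

Lemma beta_superadd (R : realType) (g : R) p q : 1 < g ->
  beta g (p + q) <= beta g p + beta g q.
Proof.
move=> g1; rewrite /beta natrD.
have := ler0n R p; have := ler0n R q; move: (p%:R : R) (q%:R : R) => x y y0 x0.
by rewrite !minEle; do !case: ifP; lra.
Qed.

(** Two capped exponents give [2 g - 1/2 >= g + 1/2], which is where [s > 5/2] enters. One capped
    and one linear give at least [g - 1/4 + 3/4], exactly the target: this ties the two constants of
    [beta]. Two linear ones are covered by the condition on [p + q]. *)
Lemma beta_top (R : realType) (g : R) p q : 1 < g -> (0 < p)%N -> (0 < q)%N ->
  g + 2^-1 <= 3 / 4 * (p + q)%:R -> g + 2^-1 <= beta g p + beta g q.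
Proof.
move=> g1 p0 q0; rewrite /beta natrD.
have : 1 <= p%:R :> R by rewrite ler1n.
have : 1 <= q%:R :> R by rewrite ler1n.
by move: (p%:R : R) (q%:R : R) => x y; rewrite !minEle; do !case: ifP; lra.
Qed.

(** The added 1/8 is the surplus of [ae_tail]: with it the exponent must stay within the order of
    the difference and below the regularity [g] of [v]. *)
Lemma beta_range (R : realType) (g : R) l : 1 < g -> (0 < l)%N ->
  [/\ 0 <= beta g l + 8^-1 <= l%:R, beta g l + 8^-1 <= g - 8^-1 & 0 < beta g l].
Proof.
move=> g1 l0; have : 1 <= l%:R :> R by rewrite ler1n.
rewrite /beta; move: (l%:R : R) => x x1; rewrite !minEle.
by case: ifP => h; split; rewrite ?ltNge; lra.
Qed.

Lemma fields_regularity (R : realType) (d : measure_display) (Omega : measurableType d)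
  (P : probability Omega R) (s : R) (a b c e : Z3 -> Omega -> R)
  (u v : Omega -> pt3 R -> R) (g : R) (m : nat) : random_fields P s a b c e u v ->
  5 / 2 < s -> g = s - 3 / 2 -> g + 1 <= m%:R ->
  {ae P, forall w, [/\
     (forall l i, (0 < l)%N -> exists j0, forall j, (j0 <= j)%N ->
        `|'D^l (fun i => u w (gpt (step R j) i)) i| <= step R j `^ (beta g l) /\
        `|'D^l (fun i => v w (gpt (step R j) i)) i| <= step R j `^ (beta g l)),
     (exists j0, forall j, (j0 <= j)%N ->
        `|'D^m (fun i => u w (gpt (step R j) i)) 0%N| <= step R j `^ (g + 2^-1)) &
     (exists j0, forall j, (j0 <= j)%N ->
        step R j `^ (g + 4^-1) <= `|'D^m (fun i => v w (gpt (step R j) i)) 0%N|)]}.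
Proof.
move=> rf s52 gE gm; have g1 : 1 < g by lra.
have up r b' l i (f : Omega -> pt3 R -> R) :
    (forall h, gauss_limit P (fun w => 'D^l (fun i => f w (gpt h i)) i) (spectral r h l)) ->
    0 <= b' + 8^-1 <= l%:R -> 3 < 2 * r - 2 * (b' + 8^-1) ->
    {ae P, forall w, exists j0, forall j, (j0 <= j)%N ->
      `|'D^l (fun i => f w (gpt (step R j) i)) i| <= step R j `^ b'}.
  move=> gl bl rb; have [K K0 HK] := spectral_upper bl rb.
  apply: (@ae_tail _ _ _ _ (fun j w => 'D^l (fun i => f w (gpt (step R j) i)) i)
    (fun j => spectral r (step R j) l) K) => //.
  by move=> j N; rewrite spectral_ge0 HK ?step_gt0.
have A1 : {ae P, forall w, forall l i, (0 < l)%N -> exists j0, forall j, (j0 <= j)%N ->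
        `|'D^l (fun i => u w (gpt (step R j) i)) i| <= step R j `^ (beta g l) /\
        `|'D^l (fun i => v w (gpt (step R j) i)) i| <= step R j `^ (beta g l)}.
  apply: ae_forall_nat => l; apply: ae_forall_nat => i.
  have [->|l0] := posnP l; first by apply: aeW.
  have [b1 b2 b3] := beta_range g1 l0.
  have hu : {ae P, forall w, exists j0, forall j, (j0 <= j)%N ->
      `|'D^l (fun i => u w (gpt (step R j) i)) i| <= step R j `^ (beta g l)}.
    by apply: (up (s + 1)) => // [h|]; [exact: gauss_limit_u rf | lra].
  have hv : {ae P, forall w, exists j0, forall j, (j0 <= j)%N ->
      `|'D^l (fun i => v w (gpt (step R j) i)) i| <= step R j `^ (beta g l)}.
    by apply: (up s) => // [h|]; [exact: gauss_limit_v rf | lra].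
  apply: filterS2 hu hv => w [j0 h0] [j1 h1] _.
  by exists (maxn j0 j1) => j; rewrite geq_max => /andP[/h0 ? /h1 ?].
(* With the surplus the exponent is [g + 5/8], still below both the regularity [g + 1] of [u] and
   the order [m]. *)
have A2 : {ae P, forall w, exists j0, forall j, (j0 <= j)%N ->
        `|'D^m (fun i => u w (gpt (step R j) i)) 0%N| <= step R j `^ (g + 2^-1)}.
  apply: (up (s + 1)) => [h||]; [exact: gauss_limit_u rf | | lra].
  by apply/andP; split; lra.
have A3 : {ae P, forall w, exists j0, forall j, (j0 <= j)%N ->
        step R j `^ (g + 4^-1) <= `|'D^m (fun i => v w (gpt (step R j) i)) 0%N|}.
  have s0 : 0 <= s by lra.
  have [K K0 HK] := spectral_lower m s0.
  apply: (@ae_lower _ _ _ _ (fun j w => 'D^m (fun i => v w (gpt (step R j) i)) 0%N)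
    (fun j => spectral s (step R j) m) K g (fun j => (2 * 2 ^ j)%N)) => //.
    by move=> j; exact: gauss_limit_v rf.
  (* [H = 2^j] is the inverse mesh, and the truncation must contain the block of frequencies between
     [H] and [2 H]. *)
  move=> j N hN; have := HK (2 ^ j)%N N; rewrite expn_gt0 /= => /(_ isT hN).
  have -> : ((2 ^ j)%:R^-1 : R) = step R j by rewrite natrX.
  by rewrite (_ : 2 * s - 3 = 2 * g) // gE; field.
by apply: filterS3 A1 A2 A3 => w ? ? ?; split.
Qed.

Lemma norm_le_fdiff (R : realType) (f : nat -> R) (B : R) M :
  (forall i, (i < M)%N -> `|'D^1 f i| <= B) ->
  forall i, (i <= M)%N -> `|f i| <= `|f 0%N| + i%:R * B.
Proof.
move=> h; elim=> [|i IH] iM; first by rewrite mul0r addr0.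
have h1 := h i iM; have h2 := IH (ltnW iM).
rewrite (_ : f i.+1 = f i + 'D^1 f i); last by rewrite /= /fdiff; ring.
by rewrite (le_trans (ler_normD _ _)) // -natr1; lra.
Qed.

(** * Roughness of the transported field *)

(** The deterministic half of the argument. [de] is chosen before [u] and [v], so the condition at
    the origin defines an event whose probability can be bounded below. *)
Lemma transported_rough (R : realType) (phi : R -> R -> R -> R * R) (k m : nat) (t g : R) :
  (3 <= k)%N -> odd k -> 0 < t -> 1 < g -> (0 < m)%N -> g + 2^-1 <= 3 / 4 * m%:R ->
  (forall a0 b0 : R, phi 0 a0 b0 = (a0, b0)) ->
  (forall a0 b0 tau : R,
     is_derive tau 1 (fun r => (phi r a0 b0).1) (phi tau a0 b0).2 /\
     is_derive tau 1 (fun r => (phi r a0 b0).2) (- ((phi tau a0 b0).1 ^+ k))) ->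
  exists2 de : R, 0 < de &
  forall u v : pt3 R -> R,
    `|u (0, 0, 0)| < de -> `|v (0, 0, 0)| < de ->
    (forall l i, (0 < l)%N -> exists j0, forall j, (j0 <= j)%N ->
        `|'D^l (fun i => u (gpt (step R j) i)) i| <= step R j `^ (beta g l) /\
        `|'D^l (fun i => v (gpt (step R j) i)) i| <= step R j `^ (beta g l)) ->
    (exists j0, forall j, (j0 <= j)%N ->
        `|'D^m (fun i => u (gpt (step R j) i)) 0%N| <= step R j `^ (g + 2^-1)) ->
    (exists j0, forall j, (j0 <= j)%N ->
        step R j `^ (g + 4^-1) <= `|'D^m (fun i => v (gpt (step R j) i)) 0%N|) ->
  ~ exists j0, forall j, (j0 <= j)%N ->
     `|'D^m (fun i => (phi t (u (gpt (step R j) i)) (v (gpt (step R j) i))).1) 0%N|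
        <= step R j `^ (g + 2^-1).
Proof.
move=> k3 ok t0 g1 m0 gm phi0 dphi.
(* From [k th <= 1] follow [q <= k th <= 1] and [(2 + q) t <= 3 t]; the last summand then yields
   [t q exp(3 t) <= 1/2]. *)
pose th : R := (1 + k%:R + 2 * k%:R * t * expR (3 * t))^-1.
have k0 : 0 < k%:R :> R by rewrite ltr0n; lia.
have kt0 : 0 < 2 * k%:R * t * expR (3 * t) by rewrite !mulr_gt0 ?expR_gt0.
have den0 : 0 < 1 + k%:R + 2 * k%:R * t * expR (3 * t) by lra.
have th0 : 0 < th by rewrite invr_gt0.
have th1 : th <= 1 by rewrite invf_le1 //; lra.
case: k k3 ok k0 kt0 den0 dphi @th th0 th1 => // j0 k3 ok k0 kt0 den0 dphi th th0 th1.
set q := j0.+1%:R * th ^+ j0.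
have qk : q <= j0.+1%:R * th.
  rewrite /q ler_pM2l //; case: (j0) k3 => // j1 _.
  by rewrite exprS ler_piMr ?(ltW th0) // exprn_ile1 ?(ltW th0).
have kth : j0.+1%:R * th <= 1 by rewrite /th ler_pdivrMr //; lra.
have q0 : 0 <= q by rewrite mulr_ge0 // exprn_ge0 // ltW.
have small : t * q * expR ((2 + q) * t) <= 2^-1.
  have h1 : expR ((2 + q) * t) <= expR (3 * t) by rewrite ler_expR ler_pM2r //; lra.
  apply: (@le_trans _ _ (t * (j0.+1%:R * th) * expR (3 * t))).
    apply: ler_pM => //; [|by rewrite ler_pM2l].
    by apply: mulr_ge0 => //; exact: ltW.
  rewrite (_ : _ * _ = (t * j0.+1%:R * expR (3 * t)) * th); last by ring.
  by rewrite /th ler_pdivrMr //; lra.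
have [K K0 HK] := flow_fdiff_lower (j := j0) (@ler01 R) (ltW th0) (ltW t0) m0 small.
(* The potential energy at [th]. As [et <= 1], data bounded by [et] have energy at most [et], each
   of the two terms giving at most [et / 2]. *)
pose et := th ^+ j0.+2 / j0.+2%:R.
have et0 : 0 < et by rewrite divr_gt0 // exprn_gt0.
have et1 : et <= 1.
  rewrite ler_pdivrMr // mul1r (@le_trans _ _ 1) ?ler1n //.
  by rewrite exprn_ile1 // ltW.
have hth x y : `|x| <= et -> `|y| <= et -> forall r, `|(phi r x y).1| <= th.
  move=> xe ye; apply: (@flow_bound _ j0.+1 _ (fun r => (phi r x y).2)) => //.
  - exact: ltW.
  - by move=> r; have [] := dphi x y r.
  - by move=> r; have [] := dphi x y r.
  rewrite !phi0 /= -[leRHS]/et.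
  have y2 : y ^+ 2 <= et.
    rewrite -(real_normK (num_real y)) expr2 -[leRHS]mulr1.
    by apply: ler_pM => //; exact: le_trans et1.
  have x2 : x ^+ j0.+2 <= et.
    apply: (le_trans (ler_norm _)); rewrite normrX exprS -[leRHS]mulr1.
    by apply: ler_pM => //; rewrite ?exprn_ge0 // exprn_ile1 // (le_trans xe).
  have : x ^+ j0.+2 / j0.+2%:R <= et / 2.
    apply: (@le_trans _ _ (et / j0.+2%:R)); first by rewrite ler_pM2r // invr_gt0.
    by rewrite ler_pM2l // lef_pV2 ?posrE // ler_nat.
  by move: y2; rewrite -/et; clear; move: (x ^+ _ / _) (y ^+ 2) et => z y' et' *; lra.
(* Half of [et] is for the value at the origin, the other half for the increments over [m] grid
   points. *)
exists (et / 2); first by rewrite divr_gt0.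
move=> u v u0 v0 reg top low [jt ht].
have [jr hr] : exists j1, forall j, (j1 <= j)%N -> forall l, (l <= m)%N ->
    forall i, (i <= m)%N -> (0 < l)%N ->
      `|'D^l (fun i => u (gpt (step R j) i)) i| <= step R j `^ (beta g l) /\
      `|'D^l (fun i => v (gpt (step R j) i)) i| <= step R j `^ (beta g l).
  apply: eventually_forall_le => l _; apply: eventually_forall_le => i _.
  have [->|l0] := posnP l; first by exists 0%N.
  by have [j1 h1] := reg l i l0; exists j1 => j /h1.
have [ju hu] := top; have [jl hl] := low.
have [_ _ b10] := beta_range g1 (ltn0Sn 0).
have m0R : 0 < m%:R :> R by rewrite ltr0n.
have [|j1 h1] := @step_powR_small R (beta g 1) (et / 2 / m%:R) b10.
  by apply: divr_gt0 => //; exact: divr_gt0.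
have b4 : 0 < 4^-1 :> R by [].
(* Beyond [j2], [K h^(1/4) < t / 2], so the lower bound [h^(g + 1/4)] beats the error
   [K h^(g + 1/2)]. *)
have [|j2 h2] := @step_powR_small R 4^-1 (t / 2 / (K + 1)) b4.
  by rewrite !divr_gt0 //; lra.
pose j := maxn jt (maxn jr (maxn ju (maxn jl (maxn j1 j2)))).
have : [&& jt <= j, jr <= j, ju <= j, jl <= j, j1 <= j & j2 <= j]%N.
  by rewrite /j !leq_max !leqnn !orbT.
move=> /and5P[jtj jrj juj jlj /andP[j1j j2j]].
pose X i := u (gpt (step R j) i); pose Y i := v (gpt (step R j) i).
have g0 : gpt (step R j) 0 = (0, 0, 0) by rewrite /gpt mul0r.
have inc : m%:R * step R j `^ (beta g 1) <= et / 2.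
  by rewrite mulrC -ler_pdivlMr //; exact: h1.
have XY i : (i <= m)%N -> `|X i| <= et /\ `|Y i| <= et.
  move=> im.
  have st0 := ltW (step_powR_gt0 (beta g 1) j).
  have iB : i%:R * step R j `^ (beta g 1) <= et / 2.
    by apply: le_trans inc; rewrite ler_wpM2r // ler_nat.
  have hX p : (p < m)%N -> `|'D^1 X p| <= step R j `^ (beta g 1).
    by move=> pm; have [] := hr j jrj 1%N m0 p (ltnW pm) isT.
  have hY p : (p < m)%N -> `|'D^1 Y p| <= step R j `^ (beta g 1).
    by move=> pm; have [] := hr j jrj 1%N m0 p (ltnW pm) isT.
  have h3 := norm_le_fdiff hX im; have h4 := norm_le_fdiff hY im.
  have h5 : `|X 0%N| < et / 2 by rewrite /X g0.
  have h6 : `|Y 0%N| < et / 2 by rewrite /Y g0.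
  by split; lra.
have := HK (fun r i => (phi r (X i) (Y i)).1) (fun r i => (phi r (X i) (Y i)).2)
  (fun l => step R j `^ (beta g l)) (step R j `^ (g + 2^-1)).
have X0 : (fun i => (phi 0 (X i) (Y i)).1) = X by apply/funext => i; rewrite phi0.
have Y0 : (fun i => (phi 0 (X i) (Y i)).2) = Y by apply/funext => i; rewrite phi0.
rewrite X0 Y0 => H.
have : t / 2 * `|'D^m Y 0%N| <= K * step R j `^ (g + 2^-1).
  apply: H.
  - by move=> i r; have [] := dphi (X i) (Y i) r.
  - by move=> i r; have [] := dphi (X i) (Y i) r.
  - by move=> l; exact: powR_ge0.
  - exact: powR_ge0.
  - move=> p p' _ _ _; rewrite -step_powRD; apply: step_powR_anti.
    exact: beta_superadd.
  - move=> p p' p0 p'0 pm; rewrite -step_powRD; apply: step_powR_anti.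
    by apply: beta_top => //; rewrite pm.
  - by move=> r i _ im; have [xe ye] := XY i im; exact: hth.
  - move=> l i /andP[l0 lm] ilm; rewrite !mul1r; apply: hr => //; first exact: ltnW.
    by rewrite (leq_trans _ ilm) // leq_addr.
  - exact: hu.
  - exact: ht.
apply/negP; rewrite -ltNge.
apply: (@lt_le_trans _ _ (t / 2 * step R j `^ (g + 4^-1))); last first.
  by rewrite ler_pM2l ?divr_gt0 //; exact: hl.
rewrite (_ : g + 2^-1 = (g + 4^-1) + 4^-1); last by field.
rewrite [X in K * X]step_powRD mulrCA [ltRHS]mulrC ltr_pM2l ?step_powR_gt0 //.
have := h2 j j2j; rewrite ler_pdivlMr; last by lra.
apply: lt_le_trans; rewrite mulrC ltr_pM2l ?step_powR_gt0 //; lra.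
Qed.

(** * Measurability of the separating event *)

Lemma measurable_continuous2 (R : realType) (d : measure_display) (T : measurableType d)
  (G : R -> R -> R) (U V : T -> R) :
  (forall a b eps, 0 < eps -> exists2 de : R, 0 < de &
     forall x y, `|x - a| <= de -> `|y - b| <= de -> `|G x y - G a b| < eps) ->
  measurable_fun setT U -> measurable_fun setT V ->
  measurable_fun setT (fun w => G (U w) (V w)).
Proof.
move=> cG mU mV; apply: (measurability _ (RGenOInfty.measurableE R)) => //.
move=> _ [_ [r ->] <-]; rewrite setTI.
(* By continuity, the rational boxes on which [G] exceeds [r] cover the set where it does, and there
   are countably many. *)
pose B (i : rat * rat * nat) : set T :=
  [set w | (`|U w - ratr i.1.1| < i.2.+1%:R^-1)%R] `&`
  [set w | (`|V w - ratr i.1.2| < i.2.+1%:R^-1)%R].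
pose good (i : rat * rat * nat) := forall x y : R,
  `|x - ratr i.1.1| < i.2.+1%:R^-1 -> `|y - ratr i.1.2| < i.2.+1%:R^-1 -> r < G x y.
have -> : (fun w => G (U w) (V w)) @^-1` `]r, +oo[%classic =
    \bigcup_(i : rat * rat * nat) (if `[< good i >] then B i else set0).
  apply/seteqP; split => w /=; last first.
    move=> [i _]; case: asboolP => // gi [h1 h2]; rewrite in_itv /= andbT.
    exact: gi.
  rewrite in_itv /= andbT => rG.
  have [|de de0 hde] := cG (U w) (V w) (G (U w) (V w) - r); first by rewrite subr_gt0.
  have [n hn] : exists n : nat, n.+1%:R^-1 <= de / 2.
    exists (Num.bound (2 / de)).
    rewrite -[leRHS]invrK lef_pV2 ?posrE ?invr_gt0 ?divr_gt0 // invf_div.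
    have := archi_boundP (_ : 0 <= 2 / de); rewrite divr_ge0 ?(ltW de0) // => /(_ isT) h.
    by rewrite -natr1; lra.
  have n0 : 0 < n.+1%:R^-1 :> R by rewrite invr_gt0.
  have hq (x : R) : exists p : rat, `|x - ratr p| < n.+1%:R^-1.
    move: n0; move: (n.+1%:R^-1) => q q0.
    have [|p] := @rat_in_itvoo _ (x - q) (x + q); first by lra.
    rewrite in_itv /= => /andP[h1 h2]; exists p.
    by rewrite ltr_norml; apply/andP; split; lra.
  have [p hp] := hq (U w); have [p' hp'] := hq (V w).
  have gi : good (p, p', n).
    move=> x y /= hx hy.
    have h1 : `|x - U w| <= de.
      rewrite (_ : x - U w = (x - ratr p) - (U w - ratr p)); last by ring.
      by move: (ler_normB (x - ratr p) (U w - ratr p)) hx hp hn; move: (n.+1%:R^-1) => q'; lra.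
    have h2 : `|y - V w| <= de.
      rewrite (_ : y - V w = (y - ratr p') - (V w - ratr p')); last by ring.
      by move: (ler_normB (y - ratr p') (V w - ratr p')) hy hp' hn; move: (n.+1%:R^-1) => q'; lra.
    by have := hde x y h1 h2; rewrite ltr_norml => /andP[h3 _]; lra.
  by exists (p, p', n) => //; case: asboolP.
apply: countable_bigcupT_measurable; first exact: countableP.
move=> i; case: asboolP => // _; apply: measurableI; apply: measurable_lt_set => //;
  apply: measurableT_comp => //; exact: measurable_funB.
Qed.

Lemma measurable_eval_cyl (R : realType) (x : pt3 R) :
  measurable_fun setT (fun f : cylT R => f x).
Proof.
by move=> _ B mB; rewrite setTI; apply: sub_sigma_algebra; exists x, B.
Qed.

Lemma measurable_to_cyl (R : realType) (d : measure_display) (T : measurableType d)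
  (F : T -> pt3 R -> R * R) : (forall x, measurable_fun setT (fun w => F w x)) ->
  measurable_fun setT (F : T -> cylT R).
Proof.
move=> mF; apply: (@measurability _ _ T (cylT R) setT F (@cyl_gen R)) => //.
move=> _ [_ [x [B [mB ->]]] <-]; exact: mF.
Qed.

Unset Implicit Arguments.

Theorem theorem1p3 (R : realType) (d : measure_display) (Omega : measurableType d)
  (P : probability Omega R) (k : nat) (s t : R)
  (a b c e : Z3 -> Omega -> R)
  (u v : Omega -> pt3 R -> R)
  (phi : R -> R -> R -> R * R) :
  (3 <= k)%N -> odd k -> 5 / 2 < s -> 0 < t ->
  (* g_n = a_n + i b_n, h_n = c_n + i e_n : standard complex Gaussians *)
  mutually_independent P indep_index (gauss_family a b c e) ->
  (forall n, Z3pos n ->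
     [/\ is_centered_normal P (Num.sqrt (2^-1)) (a n),
         is_centered_normal P (Num.sqrt (2^-1)) (b n),
         is_centered_normal P (Num.sqrt (2^-1)) (c n)
       & is_centered_normal P (Num.sqrt (2^-1)) (e n)]) ->
  is_centered_normal P 1 (a (0, 0, 0)) -> is_centered_normal P 1 (c (0, 0, 0)) ->
  b (0, 0, 0) = (fun=> 0) -> e (0, 0, 0) = (fun=> 0) ->
  (* g_{-n} = conj g_n, h_{-n} = conj h_n *)
  (forall n, [/\ a (Z3neg n) = a n, b (Z3neg n) = (fun w => - b n w),
                 c (Z3neg n) = c n & e (Z3neg n) = (fun w => - e n w)]) ->
  (* u^w, v^w: measurable random fields given (a.s.) by the random Fourier series *)
  (forall x, measurable_fun setT (fun w => u w x)) ->
  (forall x, measurable_fun setT (fun w => v w x)) ->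
  {ae P, forall w, forall x,
     (fun N => cube_sum N (fun n => fourier_term (a n w) (b n w) (s + 1) n x))
       @ \oo --> u w x} ->
  {ae P, forall w, forall x,
     (fun N => cube_sum N (fun n => fourier_term (c n w) (e n w) s n x))
       @ \oo --> v w x} ->
  (* phi tau a0 b0 = solution at time tau of u' = v, v' = -u^k, (u,v)(0) = (a0,b0) *)
  (forall a0 b0 : R, phi 0 a0 b0 = (a0, b0)) ->
  (forall a0 b0 tau : R,
     is_derive tau 1 (fun r => (phi r a0 b0).1) (phi tau a0 b0).2 /\
     is_derive tau 1 (fun r => (phi r a0 b0).2) (- ((phi tau a0 b0).1 ^+ k))) ->
  ~ (pushforward P (fun w => (fun x => phi t (u w x) (v w x)) : cylT R)
     `<< pushforward P (fun w => (fun x => (u w x, v w x)) : cylT R)).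
Proof.
move=> k3 ok s52 t0 ind npos na0 nc0 b0 e0 sym mu mv cu cv phi0 dphi dom.
have rf : random_fields P s a b c e u v by split => //; split.
pose g := s - 3 / 2; have g1 : 1 < g by rewrite /g; lra.
(* [2 g + 1] meets both demands on [m]: at least [g + 1] for the top difference of [u], and
   [3/4 m >= g + 1/2] for products of uncapped orders. *)
have [m gm] : exists m : nat, 2 * g + 1 <= m%:R.
  exists (Num.bound (2 * g + 1)); apply: ltW; apply: archi_boundP; lra.
have m0 : (0 < m)%N by rewrite -(ltr0n R); apply: lt_le_trans gm; lra.
have gm1 : g + 1 <= m%:R by lra.
have gm34 : g + 2^-1 <= 3 / 4 * m%:R by lra.
have reg := fields_regularity rf s52 (erefl g) gm1.
have [de de0 rough] := transported_rough k3 ok t0 g1 m0 gm34 phi0 dphi.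
pose D j (f : cylT R) := 'D^m (fun i => (f (gpt (step R j) i)).1) 0%N.
(* The bound fails at infinitely many meshes: null for the law of the data, and of positive
   probability for the transported law. *)
pose A : set (cylT R) := lim_sup_set (fun j => [set f | (step R j `^ (g + 2^-1) < `|D j f|)%R]).
have mA : measurable A.
  apply: bigcap_measurableType => n _; apply: bigcup_measurable => j _.
  apply: measurable_lt_set => //; apply: measurableT_comp => //.
  apply: (@measurable_fdiff R _ (cylT R) (fun i f => (f (gpt (step R j) i)).1)) => i.
  exact: measurableT_comp measurable_fst (measurable_eval_cyl _).
have AP f : ~ A f -> exists j0, forall j, (j0 <= j)%N -> `|D j f| <= step R j `^ (g + 2^-1).
  move=> nA; apply: contrapT => h; apply: nA => n _; apply: contrapT => h'; apply: h.
  by exists n => j nj; rewrite leNgt; apply/negP => lt; apply: h'; exists j.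
pose X w : cylT R := fun x => (u w x, v w x).
pose Y w : cylT R := fun x => phi t (u w x) (v w x).
have mX : measurable_fun setT X.
  by apply: measurable_to_cyl => x; apply: measurable_fun_pair.
have XA : P.-negligible (X @^-1` A).
  apply: negligibleS reg => w XAw /= [_ [j0 h0] _].
  have [j /= j0j] := XAw j0 I; rewrite ltNge => /negP; apply; exact: h0.
have nullA : (pushforward P X).-null_set A.
  move=> B mB BA; rewrite /pushforward; apply: measure_negligible.
    by rewrite -[X in measurable X]setTI; exact: mX.
  by apply: negligibleS XA => w; exact: BA.
have PY0 : P (Y @^-1` A) = 0%E by exact: (dom A nullA A mA).
(* Measurability in [w] of the solution at a point comes from continuous dependence on the data. *)
have mYA : measurable (Y @^-1` A).
  have mphi x : measurable_fun setT (fun w => (phi t (u w x) (v w x)).1).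
    apply: (measurable_continuous2 (G := fun x y => (phi t x y).1)) => //.
    exact: (flow_continuous ok (ltW t0) phi0 dphi).
  have -> : Y @^-1` A = lim_sup_set (fun j => [set w | (step R j `^ (g + 2^-1) < `|D j (Y w)|)%R]).
    by [].
  apply: bigcap_measurableType => n _; apply: bigcup_measurable => j _.
  apply: measurable_lt_set => //; apply: measurableT_comp => //.
  by apply: (@measurable_fdiff R _ Omega
    (fun i w => (phi t (u w (gpt (step R j) i)) (v w (gpt (step R j) i))).1)).
have s32 : 3 / 2 < s by lra.
apply: (small_data_pos rf s32 de0); set S := [set w | _].
have mS : measurable S.
  by apply: measurableI; apply: measurable_lt_set => //; apply: measurableT_comp.
apply: measure_negligible => //.
(* Small data lie in the union of the exceptional set of [reg] and the preimage of [A] under [Y].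
   Under domination both are null, against [small_data_pos]. *)
have nYA : P.-negligible (Y @^-1` A) by exists (Y @^-1` A); split.
apply: negligibleS (negligibleU reg nYA) => w [uw vw] /=.
apply: contrapT => /not_orP[/contrapT[h1 h2 h3] nY].
exact: (rough (u w) (v w) uw vw h1 h2 h3 (AP _ nY)).
Qed.
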